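(* Let $\Omega$ be a compact Hausdorff space, let $w\mapsto\overline{w}$ be a homeomorphism of $\Omega$ of period $2$, and let $\mathcal{A}=C(\Omega,-)$. Let $n\in\mathbb{N}$ and $\Phi\in\mathrm{UCP}(\mathcal{A},M_n(\mathbb{R}))$. Then $\Phi\in\mathrm{UCP}_{C^*-ext}(\mathcal{A},M_n(\mathbb{R}))$ if and only if there exist $p,q\in\mathbb{N}\cup\{0\}$ and a subset $\{\xi_j\}_{j=1}^p\cup\{\eta_j\}_{j=1}^q\subseteq\Omega$ of distinct points, with $\xi_j=\overline{\xi_j}$ for all $j\le p$ and $\eta_i\notin\{\overline{\eta_i},\overline{\eta_j}\}$ for all $i,j\le q$ with $i\ne j$ (in particular $\eta_i\neq\overline{\eta_i}$ for every $i\le q$), such that $$\Phi\sim\Big(\bigoplus_{j=1}^p\Phi_{\xi_j}\Big)\oplus\Big(\bigoplus_{j=1}^q\Phi_{\eta_j}\Big),$$ where $\Phi_{\xi_j}=\bigoplus_{1}^{n_j}\rho_{\xi_j}$ for all $j\le p$, $\Phi_{\eta_j}\in\mathcal{E}_{\eta_j}^{m_j}$ for all $j\le q$, and $n_j,m_j\in\mathbb{N}$ are such that $\sum_{j=1}^p n_j+\sum_{j=1}^q m_j=n$.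
   Context: All linear maps are real linear. A homeomorphism of period $2$ means $\overline{\overline{w}}=w$ for all $w$ (the identity is allowed). $C(\Omega,-)=\{f:\Omega\to\mathbb{C}: f \text{ continuous},\ f(\overline{w})=\overline{f(w)}\ \forall w\in\Omega\}$ is a unital commutative real $C^*$-algebra with pointwise operations, sup norm and involution $f^*(w)=\overline{f(w)}$. For a unital real $C^*$-algebra $\mathcal{A}$ and real Hilbert space $\mathcal{H}$, $\mathscr{B}(\mathcal{H})$ is the algebra of bounded real linear operators ($M_n(\mathbb{R})=\mathscr{B}(\mathbb{R}^n)$, $T^*$ being the transpose). An element is positive if it is of the form $b^*b$. A real linear $\Phi:\mathcal{A}\to\mathscr{B}(\mathcal{H})$ is completely positive (CP) if $\sum_{i,j=1}^nT_i^*\Phi(a_i^*a_j)T_j\ge0$ for all finite families $a_j\in\mathcal{A}$, $T_j\in\mathscr{B}(\mathcal{H})$; here an operator in $\mathscr{B}(\mathcal{H})$ is positive if it has the form $B^*B$. $\mathrm{UCP}(\mathcal{A},\mathscr{B}(\mathcal{H}))$ is the set of CP maps with $\Phi(1)=I$. $\mathrm{Ad}_T(X)=T^*XT$. We write $\Phi\sim\Psi$ (unitary equivalence) if $\Psi=\mathrm{Ad}_U\circ\Phi$ for some unitary $U$ (in the real setting: real orthogonal). $\Phi\in\mathrm{UCP}(\mathcal{A},\mathscr{B}(\mathcal{H}))$ is a $C^*$-extreme point (written $\Phi\in\mathrm{UCP}_{C^*-ext}(\mathcal{A},\mathscr{B}(\mathcal{H}))$) if whenever $\Phi=\sum_{j=1}^n\mathrm{Ad}_{T_j}\circ\Phi_j$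 with $\Phi_j\in\mathrm{UCP}(\mathcal{A},\mathscr{B}(\mathcal{H}))$ and invertible $T_j\in\mathscr{B}(\mathcal{H})$ satisfying $\sum_jT_j^*T_j=I$, then $\Phi_j\sim\Phi$ for all $j$. For $w\in\Omega$, $\rho_w:\mathcal{A}\to\mathbb{R}$ is $\rho_w(f)=\mathrm{Re}\,f(w)$. For $w\ne\overline{w}$, $\Pi_w:\mathcal{A}\to M_2(\mathbb{R})$ is $\Pi_w(f)=\begin{bmatrix}\mathrm{Re}\,f(w)&\mathrm{Im}\,f(w)\\-\mathrm{Im}\,f(w)&\mathrm{Re}\,f(w)\end{bmatrix}$. Direct sums of maps are defined by $(\bigoplus_j\Phi_j)(a)=\bigoplus_j\Phi_j(a)$ (block diagonal). For $w\ne\overline{w}$ and $m\in\mathbb{N}$, $\mathcal{E}_w^m$ is the set of maps $\mathcal{A}\to M_m(\mathbb{R})$ that are finite direct sums $\bigoplus_i\Phi_i$ with each $\Phi_i\in\{\rho_w,\Pi_w,\Pi_{\overline{w}}\}$ and $\Phi_i=\rho_w$ for at most one $i$.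
   Formalization: Complete positivity is taken to include Φ(a* ) = Φ(a)*, which is automatic for n ≥ 2 but must be required for n = 1, where the claim otherwise fails (e.g. Ω = {w, w̄}, Φ = ρ_w). *)

(* Defs.v *)
From HB Require Import structures.
From mathcomp Require Import all_boot all_order all_algebra.
From mathcomp Require Import complex.
From mathcomp Require Import boolp classical_sets functions reals topology.
From mathcomp Require Import normedtype.

Set Implicit Arguments.
Unset Strict Implicit.
Unset Printing Implicit Defensive.

Import Order.TTheory GRing.Theory Num.Theory.
Import numFieldNormedType.Exports.

Local Open Scope classical_set_scope.
Local Open Scope ring_scope.

(* Complete positivity and C*-extremality only involve the unital real
   *-algebra underlying a real C*-algebra, hence no norm here. The ring
   operations are explicit fields because MathComp's algebras exclude the zero
   algebra, which is C(Omega, -) for empty Omega. *)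
Record realStarAlg (R : realType) := RealStarAlg {
  carrier :> lmodType R;
  sone : carrier;
  smul : carrier -> carrier -> carrier;
  star : carrier -> carrier;
  smulA : associative smul;
  smul1l : left_id sone smul;
  smul1r : right_id sone smul;
  smul_linearl : forall b, linear (smul^~ b);
  smul_linearr : forall a, linear (smul a);
  star_linear : linear star;
  starM : forall a b, star (smul a b) = smul (star b) (star a);
  starK : involutive star }.

Lemma sum1_ord m : (\sum_(i < m) 1)%N = m.
Proof. by rewrite sum1_card card_ord. Qed.

Section Maps.
Variables (R : realType) (A : realStarAlg R).

Definition mxpositive n (X : 'M[R]_n) := exists B : 'M[R]_n, X = B^T *m B.

Definition cp_sums n (Phi : A -> 'M[R]_n) :=
  forall (k : nat) (a : 'I_k -> A) (T : 'I_k -> 'M[R]_n),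
    mxpositive (\sum_(i < k) \sum_(j < k)
      (T i)^T *m Phi (smul (star (a i)) (a j)) *m T j).

(* The second clause follows from the first for n > 1 (see [cp_sums_herm]). For
   n = 1 it has to be required: on C, seen as a real algebra, the map
   x + i y |-> x + c y satisfies the first clause for every real c, although
   its amplifications are positive, i.e. send positive elements to matrices of
   the form B^T B, only for c = 0. *)
Definition completely_positive n (Phi : A -> 'M[R]_n) :=
  cp_sums Phi /\ forall a, Phi (star a) = (Phi a)^T.

Lemma cp_sums_herm n (Phi : A -> 'M[R]_n) :
  (1 < n)%N -> cp_sums Phi -> forall a, Phi (star a) = (Phi a)^T.
Proof.
move=> n1 cpPhi a.
have star1 : star (sone A) = sone A.
  by rewrite -[LHS]smul1r -{2}[sone A]starK -starM smul1r starK.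
have deltaE p u q v (M : 'M[R]_n) :
    (delta_mx p u)^T *m M *m delta_mx q v = M p q *: (delta_mx u v : 'M[R]_n).
  apply/matrixP => i j; rewrite !mxE (bigD1 q) //= big1 => [|l lq].
    rewrite !mxE (bigD1 p) //= big1 => [|l lp]; rewrite !mxE ?eqxx /=.
      by rewrite !addr0 -!mulrA [RHS]mulrC; case: (i == u); case: (j == v);
         rewrite ?mul1r ?mulr1 ?mul0r ?mulr0.
    by rewrite (negPf lp) mul0r.
  by rewrite !mxE (negPf lq) mulr0.
pose u : 'I_n := Ordinal (ltnW n1); pose v : 'I_n := Ordinal n1.
apply/matrixP => q p; rewrite [RHS]mxE.
have [B BE] := cpPhi 2 (fun i => if i == 0 then sone A else a)
  (fun i => if i == 0 then delta_mx p u else delta_mx q v).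
move: BE; rewrite !big_ord_recl !big_ord0 /= !addr0 !deltaE star1 smul1l.
rewrite smul1l smul1r => BE.
have /matrixP /(_ u v) : (B^T *m B)^T = B^T *m B by rewrite trmx_mul trmxK.
by rewrite -BE !mxE /= !mulr0 !mulr1 !addr0 !add0r.
Qed.

Definition UCP n (Phi : A -> 'M[R]_n) :=
  [/\ linear Phi, completely_positive Phi & Phi (sone A) = 1%:M].

Definition Ad n (T X : 'M[R]_n) : 'M[R]_n := T^T *m X *m T.

Definition orthogonal_mx n (U : 'M[R]_n) :=
  U^T *m U = 1%:M /\ U *m U^T = 1%:M.

Definition unitarily_equivalent n (Phi Psi : A -> 'M[R]_n) :=
  exists2 U : 'M[R]_n, orthogonal_mx U & forall a, Psi a = Ad U (Phi a).

Definition UCP_Cstar_ext n (Phi : A -> 'M[R]_n) :=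
  UCP Phi /\
  forall (k : nat) (Psi : 'I_k -> A -> 'M[R]_n) (T : 'I_k -> 'M[R]_n),
    (forall j, UCP (Psi j)) ->
    (forall j, T j \in unitmx) ->
    \sum_(j < k) (T j)^T *m T j = 1%:M ->
    (forall a, Phi a = \sum_(j < k) Ad (T j) (Psi j a)) ->
    forall j, unitarily_equivalent (Psi j) Phi.

Definition dsum k (d : 'I_k -> nat) (Phi : forall j, A -> 'M[R]_(d j)) :
    A -> 'M[R]_(\sum_(j < k) d j) :=
  fun a => \mxdiag_(j < k) Phi j a.

Definition dsum2 d1 d2 (Phi : A -> 'M[R]_d1) (Psi : A -> 'M[R]_d2) :
    A -> 'M[R]_(d1 + d2) :=
  fun a => block_mx (Phi a) 0 0 (Psi a).

Definition castmap d d' (e : d = d') (Phi : A -> 'M[R]_d) : A -> 'M[R]_d' :=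
  fun a => castmx (e, e) (Phi a).

End Maps.

Section ContinuousSymmetricFunctions.
Variables (R : realType) (Omega : topologicalType) (bar : Omega -> Omega).

(* [Rcomplex R] is [R[i]] as a real vector space; the usual topology of [R[i]]
   is carried by its copy [R[i]^o]. *)
Definition csym_pred : {pred Omega -> Rcomplex R} := fun f =>
  `[< continuous (f : Omega -> R[i]^o) /\
      forall w, f (bar w) = conjc (f w) >].

Record csym := CSym {
  csym_val :> Omega -> Rcomplex R;
  csym_valP : csym_val \in csym_pred }.

HB.instance Definition _ := [isSub for csym_val].
HB.instance Definition _ := [Choice of csym by <:].

Lemma csymP (f : Omega -> Rcomplex R) : reflect
  (continuous (f : Omega -> R[i]^o) /\ forall w, f (bar w) = conjc (f w))
  (f \in csym_pred).
Proof. exact: asboolP. Qed.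

Lemma csym_subring : subring_closed csym_pred.
Proof.
split.
- apply/csymP; split=> [|w]; first exact: cst_continuous.
  exact/esym/conjc1.
- move=> f g /csymP[cf sf] /csymP[cg sg]; apply/csymP; split=> [w|w].
    exact: (@continuousB _ R[i]^o _ (f : Omega -> R[i]^o) _ _ (cf w) (cg w)).
  by rewrite !fctE sf sg [RHS]rmorphB.
- move=> f g /csymP[cf sf] /csymP[cg sg]; apply/csymP; split=> [w|w].
    exact: (@continuousM R[i] _ _ _ _ (cf w) (cg w)).
  by rewrite !fctE sf sg [RHS]rmorphM.
Qed.

Lemma csym_scale : GRing.scaler_closed csym_pred.
Proof.
move=> k f /csymP[cf sf]; apply/csymP.
have E w : (k *: f) w = (k%:C)%C * f w :> R[i].
  rewrite fctE; case: (f w) => x y; apply/eqP.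
  by rewrite eq_complex /= !mul0r subr0 addr0 !eqxx.
split=> [w|w]; last first.
  by rewrite fctE sf; case: (f w) => x y; congr (_ +i* _)%C; rewrite mulrN.
have -> : (k *: f) = (fun w => (k%:C)%C * (f w : R[i]) : R[i]).
  by apply/funext => v; rewrite E.
apply: (@continuousM R[i] Omega (cst (k%:C)%C) _ _ _ (cf w)).
exact: cst_continuous.
Qed.

Lemma conjc_continuous : continuous (@conjc R : R[i]^o -> R[i]^o).
Proof.
move=> z; apply/(@cvgrPdist_lt _ R[i]^o _ (nbhs (z : R[i]^o)) (nbhs_filter _)) => e e0.
near=> y.
rewrite -[_ - _](rmorphB (@conjc R)).
have N (u : R[i]) : `|conjc u| = `|u|.
  by case: u => x t; rewrite !normc_def /= sqrrN.
rewrite [ltLHS]N; near: y.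
exact: (@cvgr_dist_lt _ R[i]^o _ (nbhs (z : R[i]^o)) _ id z cvg_id).
Unshelve. all: by end_near. Qed.

HB.instance Definition _ :=
  GRing.isSubringClosed.Build _ csym_pred csym_subring.
HB.instance Definition _ := GRing.isScaleClosed.Build R _ csym_pred csym_scale.
HB.instance Definition _ :=
  GRing.SubChoice_isSubComPzRing.Build _ _ csym csym_subring.
HB.instance Definition _ := [SubZmodule_isSubLmodule of csym by <:].

Lemma csym_star_subproof (f : csym) :
  (fun w => conjc (f w) : Rcomplex R) \in csym_pred.
Proof.
have /csymP[cf sf] := csym_valP f; apply/csymP; split=> [w|w]; last first.
  by rewrite sf.
apply: (@continuous_comp _ _ _ (csym_val f : Omega -> R[i]^o)
  (@conjc R : R[i]^o -> R[i]^o)); [exact: cf | exact: conjc_continuous].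
Qed.

Definition csym_star (f : csym) : csym := CSym (csym_star_subproof f).

Lemma csym_mull_linear (g : csym) : linear ((fun f => f * g) : csym -> csym).
Proof.
move=> k f1 f2; rewrite mulrDl; congr (_ + _); apply: val_inj.
by apply/funext => w /=; rewrite !fctE /= -scalerAl.
Qed.

Lemma csym_mulr_linear (g : csym) : linear ((fun f => g * f) : csym -> csym).
Proof. by move=> k f1 f2; rewrite mulrC csym_mull_linear ![_ * g]mulrC. Qed.

Lemma csym_star_linear : linear csym_star.
Proof.
move=> k f1 f2; apply: val_inj; apply/funext => w.
rewrite /= !fctE; case: (csym_val f1 w) (csym_val f2 w) => [a b] [c d].
by congr (_ +i* _)%C; rewrite mulrN -opprD.
Qed.

Lemma csym_starM f g : csym_star (f * g) = csym_star g * csym_star f.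
Proof.
by rewrite mulrC; apply: val_inj; apply/funext => w; exact: (rmorphM (@conjc R)).
Qed.

Lemma csym_starK : involutive csym_star.
Proof. by move=> f; apply: val_inj; apply/funext => w; exact: conjcK. Qed.

Definition COmega : realStarAlg R :=
  @RealStarAlg R csym 1 *%R csym_star (@mulrA _) (@mul1r _) (@mulr1 _)
    csym_mull_linear csym_mulr_linear csym_star_linear csym_starM csym_starK.

Definition csym_eval (f : COmega) (w : Omega) : R[i] := csym_val f w.

Definition rho (w : Omega) : COmega -> 'M[R]_1 :=
  fun f => (complex.Re (csym_eval f w))%:M.

Definition Pi (w : Omega) : COmega -> 'M[R]_2 :=
  fun f => let z := csym_eval f w in
    block_mx (complex.Re z)%:M (complex.Im z)%:M
             (- complex.Im z)%:M (complex.Re z)%:M : 'M[R]_(1 + 1).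

Definition rho_copies (w : Omega) (m : nat) : COmega -> 'M[R]_m :=
  castmap (sum1_ord m) (dsum (fun _ : 'I_m => rho w)).

Inductive summand := Srho | SPi | SPibar.

Definition summand_dim (c : summand) : nat := if c is Srho then 1 else 2.

Definition summand_map (w : Omega) (c : summand) :
    COmega -> 'M[R]_(summand_dim c) :=
  match c with
  | Srho => rho w
  | SPi => Pi w
  | SPibar => Pi (bar w)
  end.

Definition in_E (w : Omega) (m : nat) (Phi : COmega -> 'M[R]_m) :=
  exists (k : nat) (c : 'I_k -> summand)
         (e : (\sum_(i < k) summand_dim (c i))%N = m),
    (forall i j, c i = Srho -> c j = Srho -> i = j) /\
    forall f, Phi f = castmap e (dsum (fun i => summand_map w (c i))) f.

End ContinuousSymmetricFunctions.

(* Main.v *)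
(* Write B for the self-adjoint part of C(Omega, -), the even real functions.
   If Phi is C*-extreme, cutting it as Phi(g .) + Phi((1 - g) .) with g in B makes
   det Phi multiplicative along B; comparing characteristic polynomials, v^2 and v
   in B satisfy tr Phi(v^2) = tr Phi(v)^2, so by the Schwarz inequality Phi is
   multiplicative on B. Hence Phi(B) is diagonalized by evaluations at points w_i, and
   Phi(f) = diag Re f(w_i) + S diag Im f(w_i) for a skew contraction S. Extremality
   together with the parallelogram identity for the Frobenius norm forbids nonzero
   perturbations S +- H, so 1 + S^2 has rank at most one over each nonreal point;
   splitting off the eigenlines of S^2 gives the normal form.

   Conversely, if a map Phi in normal form is the sum of the Ad T_j o Psi_j, then T_j
   intertwines Phi and Psi_j wherever Phi is multiplicative, that is off the span of
   the vectors carrying the summands rho_w with w nonreal. On that span T_j is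
   replaced by its inverse transpose, and polar decomposition turns the resulting
   similarity into an orthogonal equivalence. *)

(* Extremality makes every piece of a decomposition orthogonally equivalent to Phi, so the forward
   direction compares invariants of orthogonal conjugation. The determinant suits the cut by g: with
   N^2 = Phi(g), the first piece is f |-> N^-1 Phi(g f) N^-1, and [\det] turns the conjugating
   factors into a scalar. The Frobenius norm suits perturbations of S, and one test function is
   enough for it: an odd [k0] equal to 1 at all nonreal points w_i, since Phi(k0) = S determines Phi
   on odd functions.

   At most one rho_w survives over a nonreal w because two of them give orthonormal u, v in the
   kernel of S, and e (u^T v - v^T u) could then be added to S with either sign.

   The obstacle in the converse is that Phi has a strict Schwarz inequality for odd functions at
   these summands, so T_j is not known to intertwine there. The inverse transpose of T_j still
   intertwines on B, and it sends these coordinates into the kernel of Psi_j(k) for every odd k: the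
   points lie in different orbits, which makes the relevant compression diagonal, and skew-symmetry
   of Psi_j(k) kills the diagonal. *)
Require Import Defs.
From mathcomp Require Import all_boot all_order all_algebra.
From mathcomp Require Import ring lra.
From mathcomp Require Import complex.
From mathcomp Require Import boolp classical_sets functions reals topology.
From mathcomp Require Import normedtype realfun.

Set Implicit Arguments.
Unset Strict Implicit.
Unset Printing Implicit Defensive.

Import Order.TTheory GRing.Theory Num.Theory.
Import numFieldNormedType.Exports.

Local Open Scope classical_set_scope.
Local Open Scope ring_scope.

(** * Real symmetric matrices *)

Section MatrixEntries.
Variable R : comPzRingType.
Implicit Types m n : nat.

Lemma mxDE m n (A B : 'M[R]_(m, n)) i j : (A + B) i j = A i j + B i j.
Proof. exact: mxE. Qed.

Lemma mxNE m n (A : 'M[R]_(m, n)) i j : (- A) i j = - A i j.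
Proof. exact: mxE. Qed.

Lemma mxZE m n c (A : 'M[R]_(m, n)) i j : (c *: A) i j = c * A i j.
Proof. exact: mxE. Qed.

Lemma mx0E m n i j : (0 : 'M[R]_(m, n)) i j = 0.
Proof. exact: mxE. Qed.

Lemma trmxN m n (A : 'M[R]_(m, n)) : (- A)^T = - A^T.
Proof. exact: linearN. Qed.

Lemma trmxD m n (A B : 'M[R]_(m, n)) : (A + B)^T = A^T + B^T.
Proof. exact: linearD. Qed.

Lemma trmxZ m n c (A : 'M[R]_(m, n)) : (c *: A)^T = c *: A^T.
Proof. exact: linearZ. Qed.

End MatrixEntries.

Ltac mx_expand := rewrite ?(trmx_mul, trmxD, trmxN, trmxZ, trmxK, trmx1,
  mulmxDl, mulmxDr, mulmxN, mulNmx, scalerDr, scalerN, =^~ scalemxAr,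
  =^~ scalemxAl, scalerA, mulmxA, mulmx1, mul1mx).

(* Products of matrices are atoms for [ring], applied entrywise. *)
Ltac mx_ring := apply/matrixP => ? ?; rewrite ?(mxDE, mxNE, mxZE, mx0E); ring.

Section SymmetricMatrices.
Variable R : realType.
Implicit Types n m k : nat.

Lemma row_norm_ge0 n (v : 'rV[R]_n) : 0 <= (v *m v^T) 0 0.
Proof.
by rewrite mxE; apply: sumr_ge0 => i _; rewrite mxE -expr2 sqr_ge0.
Qed.

Lemma row_norm_eq0 n (v : 'rV[R]_n) : (v *m v^T) 0 0 = 0 -> v = 0.
Proof.
rewrite mxE => /eqP; rewrite psumr_eq0 => [/allP v0|i _]; last first.
  by rewrite mxE -expr2 sqr_ge0.
apply/rowP => i; have := v0 i (mem_index_enum _).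
by rewrite !mxE /= mulf_eq0 orbb => /eqP.
Qed.

Lemma mxtrace_mul_tr m n (B : 'M[R]_(m, n)) :
  \tr (B^T *m B) = \sum_(i < n) \sum_(j < m) B j i ^+ 2.
Proof.
by apply: eq_bigr => i _; rewrite mxE; apply: eq_bigr => j _; rewrite mxE expr2.
Qed.

Lemma mxtrace_mul_tr_ge0 m n (B : 'M[R]_(m, n)) : 0 <= \tr (B^T *m B).
Proof.
by rewrite mxtrace_mul_tr; do 2![apply: sumr_ge0 => ? _]; rewrite sqr_ge0.
Qed.

Lemma mxtrace_mul_tr_eq0 m n (B : 'M[R]_(m, n)) : \tr (B^T *m B) = 0 -> B = 0.
Proof.
rewrite mxtrace_mul_tr => /eqP; rewrite psumr_eq0 => [/allP B0|i _]; last first.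
  by apply: sumr_ge0 => ? _; rewrite sqr_ge0.
apply/matrixP => j i; have := B0 i (mem_index_enum _).
rewrite /= psumr_eq0 => [/allP Bi0|k _]; last by rewrite sqr_ge0.
by have := Bi0 j (mem_index_enum _); rewrite /= sqrf_eq0 mxE => /eqP.
Qed.

(** The complexification of M is Hermitian, hence diagonalizable with real eigenvalues, and applying
    M - a for each eigenvalue a kills every vector. The product is a [foldl], so that its
    intermediate values stay available in the search for an eigenvector. *)
Lemma sym_annihilator n (M : 'M[R]_n) : M^T = M ->
  exists rs : seq R,
    forall v : 'rV_n, foldl (fun u a => u *m M - a *: u) v rs = 0.
Proof.
move=> symM; pose MC : 'M[R[i]]_n := map_mx (real_complex R) M.
have hM : MC \is hermsymmx.
  apply/is_hermitianmxP; rewrite expr0 scale1r.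
  apply/matrixP => i j; rewrite !mxE -{1}symM mxE.
  by apply/eqP; rewrite eq_complex /= oppr0 !eqxx.
have := hermitian_normalmx hM => /orthomx_spectralP.
have := hermitian_spectral_diag_real hM; move: (spectral_unit MC).
move: (spectralmx MC) (spectral_diag MC) => P D Pu Dr ME.
have DE j : D 0 j = ((complex.Re (D 0 j))%:C)%C.
  by rewrite RRe_real //; apply: (mxOverP Dr).
exists [seq complex.Re (D 0 j) | j <- enum 'I_n] => v.
set rs := map _ _.
(* In eigenbasis coordinates, each factor multiplies the j-th coordinate by D_j - a. *)
have foldE s (u : 'rV[R]_n) j :
    (map_mx (real_complex R) (foldl (fun u a => u *m M - a *: u) u s)
       *m invmx P) 0 j =
    (\prod_(a <- s) (D 0 j - (a%:C)%C)) * (map_mx (real_complex R) u *m invmx P) 0 j.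
  elim: s u => [|a s IH] u /=; first by rewrite big_nil mul1r.
  rewrite IH big_cons mulrAC [RHS]mulrC; congr (_ * _); rewrite map_mxB map_mxM map_mxZ.
  rewrite -/MC {1}ME mulmxBl -!mulmxA mulmxV // mulmx1 mulmxA -scalemxAl.
  by rewrite mul_mx_diag !mxE -/(real_complex R a); ring.
apply: (@map_mx_inj _ _ (real_complex R)); rewrite map_mx0.
apply: (can_inj (mulmxK (etrans (unitmx_inv P) Pu))); rewrite mul0mx.
apply/rowP => j; rewrite foldE [in RHS]mxE (big_rem (complex.Re (D 0 j))) /=.
  by rewrite {1}DE subrr !mul0r.
by apply/mapP; exists j; rewrite ?mem_enum.
Qed.

(** The successive images of v stay in V and end at 0; the last nonzero one is an eigenvector. *)
Lemma sym_eigenvector_in n (M : 'M[R]_n) (V : 'rV[R]_n -> Prop) (v : 'rV_n) :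
    M^T = M -> (forall u a, V u -> V (u *m M - a *: u)) -> V v -> v != 0 ->
  exists u a, [/\ V u, u != 0 & u *m M = a *: u].
Proof.
move=> symM stabV; have [rs] := sym_annihilator symM => /(_ v).
elim: rs v => [|a rs IH] v /=; first by move=> -> _; rewrite eqxx.
have [/eqP ev0 _ Vv vn0|evn0 rs0 Vv _] := eqVneq (v *m M - a *: v) 0.
  by exists v, a; split=> //; apply/eqP; rewrite -subr_eq0.
exact: IH rs0 (stabV _ _ Vv) evn0.
Qed.

(** Induction on the rank of W: if some [F g] is not scalar on W, then W is replaced by its
    intersection with an eigenspace of [F g], which is smaller, nonzero, and stable because the
    family commutes. The index type may thus be infinite. *)
Lemma sym_family_eigenvector n (G : Type) (F : G -> 'M[R]_n) (W : 'M[R]_n) :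
    (forall g, (F g)^T = F g) -> (forall g h, F g *m F h = F h *m F g) ->
    (forall g, stablemx W (F g)) -> W != 0 ->
  exists (u : 'rV_n) (a : G -> R),
    [/\ (u <= W)%MS, u != 0 & forall g, u *m F g = a g *: u].
Proof.
move=> symF comF; have [d] := ubnP (\rank W).
elim: d W => // d IH W rkW stW Wn0.
have [eigW|] := pselect (forall g, exists a, (W <= eigenspace (F g) a)%MS).
  have [a aP] := choice eigW; exists (nz_row W), a; split.
  - exact: nz_row_sub.
  - by rewrite nz_row_eq0.
  - by move=> g; apply/eigenspaceP/(submx_trans (nz_row_sub W)).
move=> /existsNP[g noeig].
have [u [a [uW un0 ue]]] : exists (u : 'rV_n) (a : R),
    [/\ (u <= W)%MS, u != 0 & u *m F g = a *: u].
  apply: (@sym_eigenvector_in _ (F g) (fun u => (u <= W)%MS) (nz_row W)).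
  - exact: symF.
  - move=> u a uW; rewrite addmx_sub // ?eqmx_opp ?scalemx_sub //.
    exact: submx_trans (submxMr _ uW) (stW g).
  - exact: nz_row_sub.
  - by rewrite nz_row_eq0.
have uW' : (u <= W :&: eigenspace (F g) a)%MS.
  by rewrite sub_capmx uW; apply/eigenspaceP.
have [|h||u' [b [u'W u'n0 u'e]]] := IH (W :&: eigenspace (F g) a)%MS.
- move: rkW; rewrite ltnS => rkW; apply: leq_trans rkW.
  rewrite ltn_neqAle mxrankS ?capmxSl // andbT; apply/negP => /eqP rkE; apply: noeig; exists a.
  have /(geq_leqif)/esym := mxrank_leqif_eq (capmxSl W (eigenspace (F g) a)).
  by rewrite rkE leqnn => /andP[_]; rewrite sub_capmx submx_refl.
- rewrite sub_capmx (submx_trans (submxMr _ (capmxSl _ _)) (stW h)) /=.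
  apply: submx_trans (submxMr _ (capmxSr _ _)) _.
  exact: comm_mx_stable_eigenspace (comF _ _).
- by apply: contraNneq un0 => W0; move: uW'; rewrite W0 submx0.
exists u', b; split=> //; exact: submx_trans u'W (capmxSl _ _).
Qed.

Lemma normalize n (v : 'rV[R]_n) : v != 0 ->
  exists2 c : R, c != 0 & (c *: v) *m (c *: v)^T = 1%:M.
Proof.
move=> vn0; pose r := (v *m v^T) 0 0.
have r0 : 0 < r.
  rewrite lt_neqAle row_norm_ge0 andbT eq_sym.
  by apply: contra vn0 => /eqP/row_norm_eq0 ->.
have s0 : Num.sqrt r != 0 by rewrite gt_eqF // sqrtr_gt0.
exists (Num.sqrt r)^-1; first by rewrite invr_eq0.
rewrite linearZ -scalemxAl -scalemxAr scalerA [v *m _]mx11_scalar -/r.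
rewrite scale_scalar_mx; congr (_%:M).
by rewrite -{3}(sqr_sqrtr (ltW r0)) expr2; field.
Qed.

Lemma orthonormal_row_free k n (W : 'M[R]_(k, n)) :
  W *m W^T = 1%:M -> row_free W.
Proof. by move=> WW; apply/row_freeP; exists W^T. Qed.

Lemma orthonormal_leq k n (W : 'M[R]_(k, n)) : W *m W^T = 1%:M -> (k <= n)%N.
Proof. by move=> /orthonormal_row_free/eqP <-; apply: rank_leq_col. Qed.

Lemma orthonormal_compl k n (W : 'M[R]_(k, n)) :
  W *m W^T = 1%:M -> (k < n)%N -> kermx W^T != 0.
Proof.
move=> /orthonormal_row_free/eqP rkW kn.
by rewrite -mxrank_eq0 mxrank_ker mxrank_tr rkW subn_eq0 -ltnNge.
Qed.

(** The rows of U are found one at a time: [kermx U^T] is the orthogonal complement of those already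
    found, and symmetry makes it stable. *)
Theorem sym_family_diag n (G : Type) (F : G -> 'M[R]_n) :
    (forall g, (F g)^T = F g) -> (forall g h, F g *m F h = F h *m F g) ->
  exists (U : 'M[R]_n) (a : 'I_n -> G -> R), U *m U^T = 1%:M /\
    forall g, U *m F g = diag_mx (\row_i a i g) *m U.
Proof.
move=> symF comF.
suff ex k : (k <= n)%N -> exists (U : 'M[R]_(k, n)) (a : 'I_k -> G -> R),
    U *m U^T = 1%:M /\ forall g, U *m F g = diag_mx (\row_i a i g) *m U.
  exact: ex.
elim: k => [_|k IH kn].
  by exists 0, (fun _ _ => 0); split=> [|g]; apply/matrixP => -[].
have [U [a [UU Ua]]] := IH (ltnW kn).
have [g||v [b [vK vn0 vb]]] := sym_family_eigenvector (W := kermx U^T) symF comF.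
- apply/sub_kermxP; rewrite -mulmxA -{1}[F g]symF -trmx_mul Ua trmx_mul.
  by rewrite mulmxA mulmx_ker mul0mx.
- exact: orthonormal_compl.
have vU : v *m U^T = 0 by apply/sub_kermxP.
have [c c0 cv] := normalize vn0.
rewrite -[k.+1]/(1 + k)%N.
exists (col_mx (c *: v) U).
exists (fun i : 'I_(1 + k) => match fintype.split i with inl _ => b | inr j => a j end).
have vU' : (c *: v) *m U^T = 0 by rewrite -scalemxAl vU scaler0.
split=> [|g].
  rewrite tr_col_mx mul_col_row cv UU vU'.
  by rewrite -[U *m _]trmxK trmx_mul trmxK vU' trmx0 -scalar_mx_block.
rewrite mul_col_mx Ua -scalemxAl vb; apply/matrixP => i j.
rewrite !mul_diag_mx !mxE.
by case: (fintype.split i) => l; rewrite !mxE //; ring.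
Qed.

Definition psd n (M : 'M[R]_n) :=
  M^T = M /\ forall v : 'rV_n, 0 <= (v *m M *m v^T) 0 0.

Lemma psd_sqrt n (M : 'M[R]_n) : psd M ->
  exists N : 'M_n, [/\ N^T = N, N *m N = M &
    forall X, X *m M = M *m X -> X *m N = N *m X].
Proof.
move=> [symM M0].
have [//|//|U [a' [UU Ua']]] := @sym_family_diag n unit (fun _ => M).
have {a' Ua'}[a Ua] : exists a : 'rV_n, U *m M = diag_mx a *m U.
  by exists (\row_i a' i tt); apply: (Ua' tt).
have UU' : U^T *m U = 1%:M by apply: mulmx1C.
have ME : M = U^T *m diag_mx a *m U by rewrite -mulmxA -Ua mulmxA UU' mul1mx.
have a0 i : 0 <= a 0 i.
  have := M0 (delta_mx 0 i *m U); rewrite trmx_mul trmx_delta !mulmxA.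
  rewrite -(mulmxA _ U M) Ua -!mulmxA (mulmxA U) UU mul1mx -colE -rowE.
  by rewrite !mxE eqxx mulr1n.
pose b : 'rV_n := \row_i Num.sqrt (a 0 i).
have bb : diag_mx b *m diag_mx b = diag_mx a.
  rewrite mulmx_diag; congr diag_mx; apply/rowP => i.
  by rewrite !mxE -expr2 sqr_sqrtr.
exists (U^T *m diag_mx b *m U); split.
- by rewrite !trmx_mul trmxK tr_diag_mx mulmxA.
- by rewrite ME -!mulmxA (mulmxA U) UU mul1mx (mulmxA (diag_mx b)) bb.
- move=> X XM; pose Y := U *m X *m U^T.
  have XE : X = U^T *m Y *m U.
    by rewrite /Y !mulmxA UU' mul1mx -!mulmxA UU' mulmx1.
  have Ya : Y *m diag_mx a = diag_mx a *m Y.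
    have aE : diag_mx a = U *m M *m U^T by rewrite Ua -mulmxA UU mulmx1.
    rewrite aE /Y -!mulmxA !(mulmxA U^T) UU' !mul1mx; congr (U *m _).
    by rewrite !mulmxA XM.
  (* Commuting with [diag_mx a] means that Y_ij = 0 or a_i = a_j; in the latter case the square
     roots agree too. *)
  have Yb : Y *m diag_mx b = diag_mx b *m Y.
    apply/matrixP => i j; have /matrixP/(_ i j) := Ya.
    rewrite !mul_mx_diag !mul_diag_mx !mxE mulrC => /eqP.
    rewrite -subr_eq0 -mulrBl mulf_eq0 subr_eq0 => /orP[/eqP ->|/eqP ->].
      by rewrite mulrC.
    by rewrite mul0r mulr0.
  clearbody Y; rewrite XE -!mulmxA !(mulmxA U) UU !mul1mx; congr (U^T *m _).
  by rewrite !mulmxA Yb.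
Qed.

Lemma psd_mxpositive n (M : 'M[R]_n) : mxpositive M <-> psd M.
Proof.
split=> [[B ->]|/psd_sqrt[N [symN NN _]]]; last by exists N; rewrite symN.
split=> [|v]; first by rewrite trmx_mul trmxK.
rewrite mulmxA -mulmxA -[X in _ *m X](trmxK) [X in _ *m X^T]trmx_mul !trmxK.
exact: row_norm_ge0.
Qed.

Lemma mxpositiveD n (M N : 'M[R]_n) :
  mxpositive M -> mxpositive N -> mxpositive (M + N).
Proof.
move=> /psd_mxpositive[sM M0] /psd_mxpositive[sN N0]; apply/psd_mxpositive.
split=> [|v]; first by rewrite linearD /= sM sN.
by rewrite mulmxDr mulmxDl mxE addr_ge0.
Qed.

Lemma mxpositive_mul m n (M : 'M[R]_m) (T : 'M[R]_(m, n)) :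
  mxpositive M -> mxpositive (T^T *m M *m T).
Proof.
move=> /psd_mxpositive[sM M0]; apply/psd_mxpositive.
split=> [|v]; first by rewrite !trmx_mul trmxK sM mulmxA.
by have := M0 (v *m T^T); rewrite trmx_mul trmxK !mulmxA.
Qed.

Lemma mxpositive_tr m n (B : 'M[R]_(m, n)) : mxpositive (B^T *m B).
Proof.
have : mxpositive (1%:M : 'M[R]_m) by exists 1%:M; rewrite trmx1 mulmx1.
by move=> /(@mxpositive_mul _ n _ B); rewrite mulmx1.
Qed.

Lemma mxpositiveZ n (c : R) (M : 'M[R]_n) :
  0 <= c -> mxpositive M -> mxpositive (c *: M).
Proof.
move=> c0 /psd_mxpositive[sM M0]; apply/psd_mxpositive.
split=> [|v]; first by rewrite linearZ /= sM.
by rewrite -scalemxAr -scalemxAl mxE mulr_ge0.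
Qed.

Lemma mxpositive_trace_ge0 n (M : 'M[R]_n) : mxpositive M -> 0 <= \tr M.
Proof. by move=> [B ->]; apply: mxtrace_mul_tr_ge0. Qed.

Lemma mxpositive_trace_eq0 n (M : 'M[R]_n) : mxpositive M -> \tr M = 0 -> M = 0.
Proof. by move=> [B ->] /mxtrace_mul_tr_eq0 ->; rewrite mulmx0. Qed.

(** On a kernel vector v of M, the form of M - c takes the value -c |v|^2, which is nonnegative only
    for v = 0. *)
Lemma mxpositive_unit n (M : 'M[R]_n) (c : R) :
  0 < c -> mxpositive (M - c%:M) -> M \in unitmx.
Proof.
move=> c0 /psd_mxpositive[_ M0]; rewrite -row_free_unit -kermx_eq0.
apply: contraT => /rowV0Pn[v /sub_kermxP vM vn0].
have := M0 v; rewrite mulmxBr vM sub0r mul_mx_scalar mulNmx -scalemxAl !mxE.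
rewrite oppr_ge0 pmulr_rle0 // => v0.
have /row_norm_eq0 vE : (v *m v^T) 0 0 = 0.
  by apply/le_anti; rewrite row_norm_ge0 mxE v0.
by rewrite vE eqxx in vn0.
Qed.

(** The crude constant, the sum of all |Y_ij|, works because |v_i v_j| <= |v|^2. It serves to choose
    the size of a perturbation. *)
Lemma quadratic_form_bound n (Y : 'M[R]_n) :
  exists2 c : R, 0 <= c & forall v : 'rV_n,
    `|(v *m Y *m v^T) 0 0| <= c * (v *m v^T) 0 0.
Proof.
exists (\sum_i \sum_j `|Y i j|) => [|v].
  by rewrite sumr_ge0 // => i _; rewrite sumr_ge0.
have vv i j : `|v 0 i * v 0 j| <= (v *m v^T) 0 0.
  rewrite mxE; have sq (k : 'I_n) : v 0 k ^+ 2 <= \sum_l v 0 l * v^T l 0.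
    rewrite (bigD1 k) //= mxE -expr2 lerDl sumr_ge0 // => l _.
    by rewrite mxE -expr2 sqr_ge0.
  rewrite -(@ler_pXn2r _ 2) ?nnegrE //; last first.
    by rewrite (le_trans _ (sq i)) ?sqr_ge0.
  rewrite real_normK ?num_real // exprMn [leRHS]expr2.
  by rewrite ler_pM ?sqr_ge0.
rewrite mulrC mxE; apply: le_trans (ler_norm_sum _ _ _) _; rewrite exchange_big mulr_sumr.
apply: ler_sum => j _; rewrite mxE [_^T _ _]mxE mulr_suml mulr_sumr.
apply: le_trans (ler_norm_sum _ _ _) _; apply: ler_sum => i _.
by rewrite mulrAC normrM ler_wpM2r.
Qed.

End SymmetricMatrices.

(** * Completely positive maps *)

Section LinearMaps.
Variables (R : realType) (V W : lmodType R) (f : V -> W).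
Hypothesis linf : linear f.

Lemma linear_fD a b : f (a + b) = f a + f b.
Proof. by have := linf 1 a b; rewrite !scale1r. Qed.

Lemma linear_f0 : f 0 = 0.
Proof. by apply: (addIr (f 0)); rewrite -linear_fD !add0r. Qed.

Lemma linear_fZ k a : f (k *: a) = k *: f a.
Proof. by rewrite -[k *: a]addr0 linf linear_f0 addr0. Qed.

Lemma linear_fN a : f (- a) = - f a.
Proof. by rewrite -scaleN1r linear_fZ scaleN1r. Qed.

Lemma linear_fB a b : f (a - b) = f a - f b.
Proof. by rewrite linear_fD linear_fN. Qed.

End LinearMaps.

Section CompletelyPositiveMaps.
Variables (R : realType) (A : realStarAlg R).
Implicit Types (n : nat) (a f g : A).

Lemma star1 : star (sone A) = sone A.
Proof. by rewrite -[LHS]smul1r -{2}[sone A]starK -starM smul1r starK. Qed.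

Lemma UCP_star n (Phi : A -> 'M[R]_n) : UCP Phi ->
  forall a, Phi (star a) = (Phi a)^T.
Proof. by move=> [_ [_ starPhi] _]. Qed.

Lemma UCP_linear n (Phi : A -> 'M[R]_n) : UCP Phi -> linear Phi.
Proof. by case. Qed.

Lemma UCP_schwarz n (Phi : A -> 'M[R]_n) f : UCP Phi ->
  mxpositive (Phi (smul (star f) f) - (Phi f)^T *m Phi f).
Proof.
move=> [_ [cpPhi starPhi] Phi1].
(* With the family (1, f) and the coefficients (-Phi(f), 1), the sum of complete positivity is
   exactly the Schwarz defect. *)
have := cpPhi 2 (fun i => if i == 0 then sone A else f)
  (fun i => if i == 0 then - Phi f else 1%:M).
rewrite !big_ord_recl !big_ord0 /= !addr0 star1 !smul1l smul1r Phi1 starPhi.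
rewrite -/(mxpositive _); congr mxpositive; mx_expand; mx_ring.
Qed.

(* The Schwarz inequality for [f + t g], [t] a matrix, forces the off-diagonal
   term of a positive form with a zero diagonal entry to vanish. *)
Lemma UCP_multiplicative_domain n (Phi : A -> 'M[R]_n) g : UCP Phi ->
    Phi (smul (star g) g) = (Phi g)^T *m Phi g ->
  forall f, Phi (smul f g) = Phi f *m Phi g.
Proof.
move=> [_ [cpPhi starPhi] Phi1] gg f.
pose D := Phi (smul f g) - Phi f *m Phi g.
have DT : D^T = Phi (smul (star g) (star f)) - (Phi g)^T *m (Phi f)^T.
  by rewrite /D linearB /= trmx_mul -!starPhi starM.
pose D0 := Phi (smul f (star f)) - Phi f *m (Phi f)^T.
have pos (t : R) : 0 <= \tr D0 - (2 * t) * \tr (D *m D^T).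
  (* The family (1, f^*, g) below, with coefficients (-(Phi(f)^T + Phi(g) X), 1, X), expresses the
     Schwarz inequality for f^* + g X. The g-g terms cancel and leave D0 + D X + X^T D^T. *)
  pose X := - t *: D^T.
  have := cpPhi 3 (fun i => if i == 0 then sone A else if i == 1 then star f else g)
    (fun i => if i == 0 then - ((Phi f)^T + Phi g *m X)
              else if i == 1 then 1%:M else X).
  rewrite !big_ord_recl !big_ord0 /= !addr0 star1 starK !smul1l !smul1r Phi1.
  have -> : Phi (smul f g) = D + Phi f *m Phi g by rewrite subrK.
  have -> : Phi (smul (star g) (star f)) = D^T + (Phi g)^T *m (Phi f)^T.
    by rewrite DT subrK.
  have -> : Phi (smul f (star f)) = D0 + Phi f *m (Phi f)^T by rewrite subrK.
  rewrite gg !starPhi => /mxpositive_trace_ge0; congr (_ <= _).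
  transitivity (\tr (D0 + D *m X + X^T *m D^T)).
    by congr (\tr _); mx_expand; mx_ring.
  rewrite /X !mxtraceD trmxZ trmxK -scalemxAr -scalemxAl !mxtraceZ; ring.
have [//|DDpos] := leP (\tr (D *m D^T)) 0.
  move=> DD; have DD0 : \tr (D *m D^T) = 0.
    by apply/le_anti; rewrite DD -{1}[D]trmxK mxtrace_mul_tr_ge0.
  have /mxtrace_mul_tr_eq0/(congr1 trmx) : \tr ((D^T)^T *m D^T) = 0.
    by rewrite trmxK.
  by rewrite trmxK trmx0 => /eqP; rewrite subr_eq0 => /eqP.
(* At this t the expression that [pos] bounds below by 0 equals -1. *)
have := pos ((\tr D0 + 1) / (2 * \tr (D *m D^T))).
set d := \tr (D *m D^T) in DDpos *; set t := \tr D0.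
have -> : t - 2 * ((t + 1) / (2 * d)) * d = -1 by field; rewrite gt_eqF.
by rewrite lerNr oppr0 ler10.
Qed.

Lemma cp_sums_Ad n (Phi : A -> 'M[R]_n) (T : 'M[R]_n) :
  cp_sums Phi -> cp_sums (fun a => Ad T (Phi a)).
Proof.
move=> cpPhi k a S; have [B BE] := cpPhi k a (fun i => T *m S i).
exists B; rewrite -BE; apply: eq_bigr => i _; apply: eq_bigr => j _.
by rewrite /Ad trmx_mul !mulmxA.
Qed.

Lemma Ad_linear n (T : 'M[R]_n) (Phi : A -> 'M[R]_n) :
  linear Phi -> linear (fun a => Ad T (Phi a)).
Proof.
by move=> linPhi k a b; rewrite /Ad linPhi mulmxDr mulmxDl -scalemxAr -scalemxAl.
Qed.

Lemma UCP_Ad n (Phi : A -> 'M[R]_n) (T : 'M[R]_n) :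
  UCP Phi -> T^T *m T = 1%:M -> UCP (fun a => Ad T (Phi a)).
Proof.
move=> [linPhi [cpPhi starPhi] Phi1] TT; split; first exact: Ad_linear.
- split; first exact: cp_sums_Ad.
  by move=> a; rewrite starPhi /Ad !trmx_mul trmxK mulmxA.
- by rewrite /Ad Phi1 mulmx1.
Qed.

Lemma unitarily_equivalent_sym n (Phi Psi : A -> 'M[R]_n) :
  unitarily_equivalent Phi Psi -> unitarily_equivalent Psi Phi.
Proof.
move=> [U [UU UU'] PsiE]; exists U^T; first by split; rewrite trmxK.
by move=> a; rewrite PsiE /Ad trmxK !mulmxA UU' mul1mx -mulmxA UU' mulmx1.
Qed.

Lemma unitarily_equivalent_trans n (Phi Psi Theta : A -> 'M[R]_n) :
    unitarily_equivalent Phi Psi -> unitarily_equivalent Psi Theta ->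
  unitarily_equivalent Phi Theta.
Proof.
move=> [U [UU UU'] PsiE] [V [VV VV'] ThetaE]; exists (U *m V).
  split; rewrite trmx_mul !mulmxA.
    by rewrite -(mulmxA _ _ U) UU mulmx1.
  by rewrite -(mulmxA _ _ V^T) VV' mulmx1.
by move=> a; rewrite ThetaE PsiE /Ad trmx_mul !mulmxA.
Qed.

(** A decomposition of the conjugated map with coefficients T_i is one of Phi with coefficients T_i
    U^T and the same pieces. *)
Lemma UCP_Cstar_ext_Ad n (Phi : A -> 'M[R]_n) (U : 'M[R]_n) :
  UCP_Cstar_ext Phi -> orthogonal_mx U -> UCP_Cstar_ext (fun a => Ad U (Phi a)).
Proof.
move=> [PhiU Phi_C] [UU UU']; split; first exact: UCP_Ad.
move=> k Psi T PsiU Tu TT PsiE j.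
have Uu : U^T \in unitmx by have [] := mulmx1_unit UU.
apply: unitarily_equivalent_trans (Phi_C k Psi (fun i => T i *m U^T) _ _ _ _ j) _.
- exact: PsiU.
- by move=> i; rewrite unitmx_mul Tu.
- under eq_bigr do rewrite trmx_mul trmxK mulmxA -(mulmxA U).
  by rewrite -mulmx_suml -mulmx_sumr TT mulmx1.
- move=> a; have := PsiE a; rewrite {1}/Ad => PsiaE.
  transitivity (U *m (U^T *m Phi a *m U) *m U^T).
    by rewrite !mulmxA UU' mul1mx -mulmxA UU' mulmx1.
  rewrite PsiaE mulmx_sumr mulmx_suml; apply: eq_bigr => i _.
  by rewrite /Ad trmx_mul trmxK !mulmxA.
- by exists U.
Qed.

(* Polar decomposition: [C^T C] commutes with [Phi], hence so does its square
   root [N], and [C N^-1] is orthogonal. *)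
Lemma similar_unitarily_equivalent n (Phi Psi : A -> 'M[R]_n) (C : 'M[R]_n) :
    (forall a, Phi (star a) = (Phi a)^T) ->
    (forall a, Psi (star a) = (Psi a)^T) ->
    C \in unitmx -> (forall a, Psi a *m C = C *m Phi a) ->
  unitarily_equivalent Psi Phi.
Proof.
move=> starPhi starPsi Cu CE.
have CE' a : C^T *m Psi a = Phi a *m C^T.
  have := congr1 trmx (CE (star a)).
  by rewrite !trmx_mul starPhi starPsi !trmxK.
have [N [symN NN comN]] : exists N : 'M[R]_n, [/\ N^T = N, N *m N = C^T *m C &
    forall X, X *m (C^T *m C) = (C^T *m C) *m X -> X *m N = N *m X].
  exact/psd_sqrt/psd_mxpositive/mxpositive_tr.
have Nu : N \in unitmx.
  have : C^T *m C \in unitmx by rewrite unitmx_mul unitmx_tr Cu.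
  by rewrite -NN unitmx_mul => /andP[].
have PhiN a : Phi a *m N = N *m Phi a.
  by apply: comN; rewrite mulmxA -CE' -!mulmxA CE.
have N'T : (invmx N)^T = invmx N by rewrite trmx_inv symN.
have UU : (C *m invmx N)^T *m (C *m invmx N) = 1%:M.
  by rewrite trmx_mul N'T -mulmxA (mulmxA C^T) -NN !mulmxA mulVmx // mul1mx mulmxV.
exists (C *m invmx N); first by split=> //; apply: mulmx1C.
move=> a; rewrite /Ad trmx_mul N'T -!mulmxA (mulmxA (Psi a)) CE.
rewrite -!mulmxA (mulmxA C^T) -NN !mulmxA mulVmx // mul1mx -PhiN.
by rewrite -mulmxA mulmxV // mulmx1.
Qed.

(* The Schwarz defects of the [Psi_j] and the squares of the commutators
   [Psi_j(f) T_j - T_j Phi(f)] add up to the Schwarz defect of [Phi]. *)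
Lemma UCP_sum_intertwine n k (Phi : A -> 'M[R]_n) (Psi : 'I_k -> A -> 'M[R]_n)
    (T : 'I_k -> 'M[R]_n) (X : 'M[R]_n) f :
    (forall j, UCP (Psi j)) -> \sum_j (T j)^T *m T j = 1%:M ->
    (forall a, Phi a = \sum_j Ad (T j) (Psi j a)) ->
    X^T *m (Phi (smul (star f) f) - (Phi f)^T *m Phi f) *m X = 0 ->
  forall j, Psi j f *m T j *m X = T j *m Phi f *m X.
Proof.
move=> PsiU TT PhiE X0.
(* X localizes the argument to a subspace on which Phi has no Schwarz defect; the converse uses the
   identity and a coordinate projection. *)
pose Z j := (Psi j f *m T j - T j *m Phi f) *m X.
pose E j := Psi j (smul (star f) f) - (Psi j f)^T *m Psi j f.
have E0 j : 0 <= \tr ((T j *m X)^T *m E j *m (T j *m X)).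
  exact/mxpositive_trace_ge0/mxpositive_mul/UCP_schwarz.
have PhifT : (Phi f)^T = \sum_j (T j)^T *m (Psi j f)^T *m T j.
  rewrite PhiE linear_sum; apply: eq_bigr => j _.
  by rewrite /Ad /= !trmx_mul trmxK mulmxA.
have sumZ : \sum_j ((Z j)^T *m Z j + (T j *m X)^T *m E j *m (T j *m X)) = 0.
  apply: etrans X0; rewrite [in RHS]PhiE.
  transitivity (X^T *m (\sum_j Ad (T j) (Psi j (smul (star f) f))
     - (\sum_j (T j)^T *m (Psi j f)^T *m T j) *m Phi f
     - (Phi f)^T *m (\sum_j Ad (T j) (Psi j f))
     + (Phi f)^T *m (\sum_j (T j)^T *m T j) *m Phi f) *m X).
    rewrite !(mulmx_sumr, mulmx_suml) -!sumrN -!big_split /=.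
    rewrite !(mulmx_sumr, mulmx_suml); apply: eq_bigr => j _.
    by rewrite /Z /E /Ad; mx_expand; mx_ring.
  by rewrite TT -PhifT -!PhiE mulmx1; congr (_ *m _ *m _); mx_ring.
have /eqP : \sum_j (\tr ((Z j)^T *m Z j)
    + \tr ((T j *m X)^T *m E j *m (T j *m X))) = 0.
  by under eq_bigr do rewrite -mxtraceD; rewrite -raddf_sum sumZ raddf0.
rewrite psumr_eq0 => [/allP Z0 j|j _]; last by rewrite addr_ge0 ?mxtrace_mul_tr_ge0.
have := Z0 j (mem_index_enum _); rewrite paddr_eq0 ?mxtrace_mul_tr_ge0 //.
move=> /andP[/eqP/mxtrace_mul_tr_eq0/eqP]; rewrite /Z mulmxBl subr_eq0.
by move=> /eqP.
Qed.

End CompletelyPositiveMaps.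

(** * The algebra C(Omega, -) *)

Section ComplexTopology.
Variable R : realType.

Lemma real_complex_continuous : continuous ((fun x : R => (x%:C)%C) : R -> R[i]^o).
Proof.
move=> x; apply/(@cvgrPdist_lt _ R[i]^o _ (nbhs x) (nbhs_filter _)) => e e0.
have [e' e'0 eE] : exists2 e' : R, 0 < e' & e = (e'%:C)%C.
  by move: e0; case: e => a b; rewrite ltcE /= => /andP[/eqP -> a0]; exists a.
near=> y; rewrite -rmorphB normc_def /= expr0n addr0 sqrtr_sqr eE ltcR; near: y.
exact: (@cvgr_dist_lt _ R^o _ (nbhs x) _ id x cvg_id).
Unshelve. all: by end_near. Qed.

Lemma Re_continuous : continuous (@complex.Re R : R[i]^o -> R).
Proof.
move=> z; apply/(@cvgrPdist_lt _ R^o _ (nbhs (z : R[i]^o)) (nbhs_filter _)) => e e0.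
near=> y.
rewrite -ltcR; apply: le_lt_trans (_ : `|z - y| < _).
  by rewrite -raddfB; apply: normc_ge_Re.
near: y.
apply: (@cvgr_dist_lt _ R[i]^o _ (nbhs (z : R[i]^o)) _ id z cvg_id).
by rewrite ltcR.
Unshelve. all: by end_near. Qed.

End ComplexTopology.

Section SymmetricFunctions.
Variables (R : realType) (Omega : topologicalType).
Hypothesis Omega_compact : compact [set: Omega].
Hypothesis Omega_hausdorff : hausdorff_space Omega.
Variable bar : Omega -> Omega.
Hypothesis bar_continuous : continuous bar.
Hypothesis bar_period2 : involutive bar.

Local Notation A := (COmega R bar).
Implicit Types f g h : A.

Definition Ref f w : R := complex.Re (csym_eval f w).
Definition Imf f w : R := complex.Im (csym_eval f w).

Lemma csym_ext f g : Ref f =1 Ref g -> Imf f =1 Imf g -> f = g.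
Proof.
move=> Ref_eq Imf_eq; apply: val_inj; apply/funext => w; apply/eqP.
by rewrite eq_complex; apply/andP; split; apply/eqP; [apply: Ref_eq | apply: Imf_eq].
Qed.

Lemma RefD f g w : Ref (f + g) w = Ref f w + Ref g w.
Proof. by rewrite /Ref /Imf /csym_eval /= ?fctE; case: (csym_val f w) => ? ?; case: (csym_val g w). Qed.
Lemma ImfD f g w : Imf (f + g) w = Imf f w + Imf g w.
Proof. by rewrite /Ref /Imf /csym_eval /= ?fctE; case: (csym_val f w) => ? ?; case: (csym_val g w). Qed.
Lemma RefN f w : Ref (- f) w = - Ref f w.
Proof. by rewrite /Ref /Imf /csym_eval /= ?fctE; case: (csym_val f w). Qed.
Lemma ImfN f w : Imf (- f) w = - Imf f w.
Proof. by rewrite /Ref /Imf /csym_eval /= ?fctE; case: (csym_val f w). Qed.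
Lemma RefZ c f w : Ref (c *: f) w = c * Ref f w.
Proof. by rewrite /Ref /Imf /csym_eval /= ?fctE; case: (csym_val f w). Qed.
Lemma ImfZ c f w : Imf (c *: f) w = c * Imf f w.
Proof. by rewrite /Ref /Imf /csym_eval /= ?fctE; case: (csym_val f w). Qed.
Lemma RefM f g w : Ref (smul f g) w = Ref f w * Ref g w - Imf f w * Imf g w.
Proof. by rewrite /Ref /Imf /csym_eval /= ?fctE; case: (csym_val f w) => ? ?; case: (csym_val g w). Qed.
Lemma ImfM f g w : Imf (smul f g) w = Ref f w * Imf g w + Imf f w * Ref g w.
Proof. by rewrite /Ref /Imf /csym_eval /= ?fctE; case: (csym_val f w) => ? ?; case: (csym_val g w). Qed.
Lemma Ref1 w : Ref (sone A) w = 1.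
Proof. by []. Qed.
Lemma Imf1 w : Imf (sone A) w = 0.
Proof. by []. Qed.
Lemma Ref_star f w : Ref (star f) w = Ref f w.
Proof. by rewrite /Ref /Imf /csym_eval /= ?fctE; case: (csym_val f w). Qed.
Lemma Imf_star f w : Imf (star f) w = - Imf f w.
Proof. by rewrite /Ref /Imf /csym_eval /= ?fctE; case: (csym_val f w). Qed.


Lemma Ref_bar f w : Ref f (bar w) = Ref f w.
Proof. by have /csymP[_ sf] := csym_valP f; rewrite /Ref /csym_eval sf; case: (csym_val f w). Qed.

Lemma Imf_bar f w : Imf f (bar w) = - Imf f w.
Proof. by have /csymP[_ sf] := csym_valP f; rewrite /Imf /csym_eval sf; case: (csym_val f w). Qed.

Lemma Ref_continuous f : continuous (Ref f).
Proof.
have /csymP[cf _] := csym_valP f => w.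
exact: (@continuous_comp _ _ _ (csym_val f : Omega -> R[i]^o)
  (@complex.Re R : R[i]^o -> R) w (cf w) (@Re_continuous R _)).
Qed.

Lemma csym_of (u v : Omega -> R) : continuous u -> continuous v ->
    (forall w, u (bar w) = u w) -> (forall w, v (bar w) = - v w) ->
  exists f, Ref f =1 u /\ Imf f =1 v.
Proof.
move=> cu cv su sv.
have fP : (fun w => (u w +i* v w)%C : Rcomplex R) \in csym_pred bar.
  apply/csymP; split=> [w|w]; last by rewrite su sv.
  have -> : (fun w => (u w +i* v w)%C : Rcomplex R) =
      (fun w => ((u w)%:C)%C + 'i%C * ((v w)%:C)%C : R[i]).
    by apply/funext => x; rewrite [LHS]complexE.
  pose cplx (r : R) : R[i]^o := (r%:C)%C.
  have cc (r : Omega -> R) : continuous r ->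
      {for w, continuous (fun x => cplx (r x))}.
    move=> cr; exact: (@continuous_comp _ _ _ r cplx w (cr w)
      (@real_complex_continuous R _)).
  apply: (@continuousD _ R[i]^o Omega (fun x => cplx (u x))
    (fun x => 'i%C * cplx (v x)) w); first exact: cc.
  apply: (@continuousM R[i] Omega (cst 'i%C) (fun x => cplx (v x)) w).
    exact: cst_continuous.
  exact: cc.
by exists (CSym fP).
Qed.

Definition selfadj f := forall w, Imf f w = 0.
Definition skewadj f := forall w, Ref f w = 0.

Lemma selfadj_star f : selfadj f -> star f = f.
Proof. by move=> sf; apply: csym_ext => w; rewrite ?Ref_star ?Imf_star ?sf ?oppr0. Qed.

Lemma skewadj_star f : skewadj f -> star f = - f.
Proof. by move=> sf; apply: csym_ext => w; rewrite ?Ref_star ?Imf_star ?RefN ?ImfN ?sf ?oppr0. Qed.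

Lemma csym_decomp f : exists g h, [/\ selfadj g, skewadj h & f = g + h].
Proof.
exists (2^-1 *: (f + star f)), (2^-1 *: (f - star f)); split.
- by move=> w; rewrite ImfZ ImfD Imf_star subrr mulr0.
- by move=> w; rewrite RefZ RefD RefN Ref_star subrr mulr0.
- apply: csym_ext => w.
    by rewrite RefD !RefZ !RefD RefN Ref_star; field.
  by rewrite ImfD !ImfZ !ImfD ImfN Imf_star; field.
Qed.

Lemma selfadj_of (u : Omega -> R) : continuous u -> (forall w, u (bar w) = u w) ->
  exists2 f, selfadj f & Ref f =1 u.
Proof.
move=> cu su; have [||f [fu f0]] := @csym_of u (fun=> 0) cu _ su.
- exact: cst_continuous.
- by move=> w; rewrite oppr0.
by exists f.
Qed.

Lemma skewadj_of (v : Omega -> R) : continuous v -> (forall w, v (bar w) = - v w) ->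
  exists2 f, skewadj f & Imf f =1 v.
Proof.
move=> cv sv; have [||f [fu f0]] := @csym_of (fun=> 0) v _ cv _ sv.
- exact: cst_continuous.
- by [].
by exists f.
Qed.

Lemma selfadj_sqrt f : selfadj f -> (forall w, 0 <= Ref f w) ->
  exists2 g, selfadj g & f = smul (star g) g.
Proof.
move=> sf f0; have [||g sg gE] := @selfadj_of (fun w => Num.sqrt (Ref f w)).
- move=> w; apply: (@continuous_comp _ _ _ (Ref f) (@Num.sqrt R)).
    exact: Ref_continuous.
  exact: sqrt_continuous.
- by move=> w; rewrite Ref_bar.
exists g => //; rewrite selfadj_star //; apply: csym_ext => w.
  by rewrite RefM gE sg mul0r subr0 -expr2 sqr_sqrtr.
by rewrite ImfM sg sf mulr0 mul0r addr0.
Qed.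

Lemma selfadj_inv f : selfadj f -> (forall w, Ref f w != 0) ->
  exists2 g, selfadj g & smul f g = sone A.
Proof.
move=> sf f0; have [||g sg gE] := @selfadj_of (fun w => (Ref f w)^-1).
- move=> w; apply: (@continuousV R _ (Ref f)) => //; exact: Ref_continuous.
- by move=> w; rewrite Ref_bar.
exists g => //; apply: csym_ext => w.
  by rewrite RefM gE sg mulr0 subr0 mulfV.
by rewrite ImfM sg sf mulr0 mul0r addr0 Imf1.
Qed.

Lemma Ref_bounded f : exists M : R, forall w, `|Ref f w| <= M.
Proof.
have : compact [set Ref f w | w in [set: Omega]].
  apply: continuous_compact => //; apply: continuous_subspaceT.
  exact: Ref_continuous.
move=> /(@compact_bounded R R^o) /pinfty_ex_gt0[M M0 fM].
by exists M => w; apply: fM; exists w.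
Qed.

Lemma urysohn_finite (s t : seq Omega) : (forall x, x \in s -> x \notin t) ->
  exists u : Omega -> R, [/\ continuous u, forall x, x \in s -> u x = 1 &
    forall x, x \in t -> u x = 0].
Proof.
move=> st; have closed_seq (r : seq Omega) : closed [set` r].
  apply: (accessible_finite_set_closed.1 (hausdorff_accessible Omega_hausdorff)).
  by apply: cardinality.finite_seq.
have ts0 : [set` t] `&` [set` s] = set0.
  by rewrite -subset0 => x [/= xt /st]; rewrite xt.
have sep : uniform_separator [set` t] [set` s].
  apply: (@normal_separatorP R Omega).1 => //.
  exact: compact_normal Omega_hausdorff Omega_compact.
exists (Urysohn [set` t] [set` s]); split=> [|x xs|x xt].
- exact: Urysohn_continuous.
- by apply: (@Urysohn_sub1 _ R _ _ sep); exists x.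
- by apply: (@Urysohn_sub0 _ R _ _ sep); exists x.
Qed.

(** An even function cannot tell x from [bar x], so the Urysohn function separates the unions of
    orbits before it is averaged over [bar]. *)
Lemma selfadj_separate (s t : seq Omega) :
    (forall x y, x \in s -> y \in t -> x <> y /\ x <> bar y) ->
  exists g, [/\ selfadj g, forall x, x \in s -> Ref g x = 1 &
    forall x, x \in t -> Ref g x = 0].
Proof.
move=> st; have [|u [cu us ut]] := @urysohn_finite (s ++ map bar s) (t ++ map bar t).
  move=> x; rewrite mem_cat => /orP[xs|/mapP[y ys ->]]; rewrite mem_cat negb_or;
    apply/andP; split; apply/negP.
  - by move=> xt; have [] := st x x xs xt.
  - by move=> /mapP[y yt xE]; have [] := st x y xs yt.
  - by move=> yt; have [_] := st y _ ys yt; rewrite bar_period2.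
  - by move=> /mapP[z zt /(inv_inj bar_period2) yz]; have [] := st y z ys zt.
have [||g sg gE] := @selfadj_of (fun w => 2^-1 * (u w + u (bar w))).
- move=> w; apply: (@continuousM R _ (cst 2^-1) (fun w => u w + u (bar w))).
    exact: cst_continuous.
  apply: (@continuousD R R^o _ u (u \o bar)); first exact: cu.
  by apply: continuous_comp; [apply: bar_continuous | apply: cu].
- by move=> w; rewrite bar_period2 addrC.
exists g; split=> // x xs; rewrite gE.
  rewrite !us ?mem_cat ?xs ?map_f ?orbT // -[1 + 1]/(2%:R).
  by rewrite mulVf ?pnatr_eq0.
by rewrite !ut ?mem_cat ?xs ?map_f ?orbT // addr0 mulr0.
Qed.

(** The hypothesis for x = y excludes fixed points of [bar], where odd functions vanish. Since u is
    1 on s and 0 on its image under [bar], the difference u - u o bar takes the value 1 on s. *)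
Lemma skewadj_separate (s : seq Omega) :
    (forall x y, x \in s -> y \in s -> x <> bar y) ->
  exists k, skewadj k /\ forall x, x \in s -> Imf k x = 1.
Proof.
move=> ss; have [|u [cu us ut]] := @urysohn_finite s (map bar s).
  by move=> x xs; apply/negP => /mapP[y ys]; apply: ss.
have [||k sk kE] := @skewadj_of (fun w => u w - u (bar w)).
- move=> w; apply: (@continuousB R R^o _ u (u \o bar)); first exact: cu.
  by apply: continuous_comp; [apply: bar_continuous | apply: cu].
- by move=> w; rewrite bar_period2 opprB.
by exists k; split=> // x xs; rewrite kE us ?ut ?map_f ?subr0.
Qed.

Lemma selfadjD f g : selfadj f -> selfadj g -> selfadj (f + g).
Proof. by move=> sf sg w; rewrite ImfD sf sg addr0. Qed.

Lemma selfadjZ c f : selfadj f -> selfadj (c *: f).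
Proof. by move=> sf w; rewrite ImfZ sf mulr0. Qed.

Lemma selfadjM f g : selfadj f -> selfadj g -> selfadj (smul f g).
Proof. by move=> sf sg w; rewrite ImfM sf sg mulr0 mul0r addr0. Qed.

Lemma selfadj1 : selfadj (sone A).
Proof. by move=> w; rewrite Imf1. Qed.

(* If [a] were no evaluation, some nonnegative [h] with [a h = 0] would be
   positive at every point, by compactness, hence invertible. *)
Lemma selfadj_character (a : A -> R) :
    (forall g h, selfadj g -> selfadj h -> a (g + h) = a g + a h) ->
    (forall c g, selfadj g -> a (c *: g) = c * a g) ->
    (forall g h, selfadj g -> selfadj h -> a (smul g h) = a g * a h) ->
    a (sone A) = 1 ->
  exists w, forall g, selfadj g -> a g = Ref g w.
Proof.
move=> aD aZ aM a1; apply: contrapT => noeval.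
pose K : set A := [set h | [/\ selfadj h, forall w, 0 <= Ref h w & a h = 0]].
(* Sets containing all elements of K above some element of K form a filter, since K is closed under
   sums. Compactness as a near-covering property then turns local positivity into a single element
   of K that is positive everywhere. *)
pose F : set_system A := [set U | exists2 h0, K h0 &
  forall h, K h -> (forall w, Ref h0 w <= Ref h w) -> U h].
have a0 : a 0 = 0.
  by rewrite -[X in a X](scale0r (sone A)) aZ ?mul0r //; apply: selfadj1.
have K0 : K 0 by split=> // w; rewrite -(scale0r (sone A)) ?ImfZ ?RefZ mul0r.
have FF : Filter F.
  split.
  - by exists 0.
  - move=> P Q [h1 [s1 p1 z1] h1P] [h2 [s2 p2 z2] h2Q]; exists (h1 + h2).
      split; first exact: selfadjD.
        by move=> w; rewrite RefD addr_ge0.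
      by rewrite aD // z1 z2 addr0.
    move=> h Kh hle; split; [apply: h1P | apply: h2Q] => // w;
      apply: le_trans (hle w); rewrite RefD.
      by rewrite lerDl.
    by rewrite lerDr.
  - by move=> P Q PQ [h0 Kh0 h0P]; exists h0 => // h Kh /h0P hP; apply/PQ/hP.
have loc (w : Omega) : exists2 h, K h & 0 < Ref h w.
  have [g sg ag] : exists2 g, selfadj g & a g <> Ref g w.
    apply: contrapT => nog; apply: noeval; exists w => g sg.
    by apply: contrapT => ag; apply: nog; exists g.
  pose d := g - a g *: sone A.
  have sd : selfadj d.
    by rewrite /d -scaleNr; apply: selfadjD => //; apply/selfadjZ/selfadj1.
  have dE x : Ref d x = Ref g x - a g.
    by rewrite /d -scaleNr RefD RefZ Ref1 mulr1.
  have ad : a d = 0.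
    rewrite /d -scaleNr aD //; last exact/selfadjZ/selfadj1.
    by rewrite aZ ?a1 ?mulr1 ?subrr //; apply: selfadj1.
  (* d = g - a(g) 1 is killed by the character but does not vanish at w, so its square lies in K and
     is positive at w. *)
  exists (smul d d); first split; first exact: selfadjM.
  - by move=> x; rewrite RefM sd mul0r subr0 -expr2 sqr_ge0.
  - by rewrite aM // ad mul0r.
  - rewrite RefM sd mul0r subr0 -expr2 dE lt_neqAle sqr_ge0 andbT eq_sym.
    by rewrite sqrf_eq0 subr_eq0; apply/eqP => /esym.
have := (@compact_near_coveringP _ [set: Omega]).1 Omega_compact A F
  (fun h w => 0 < Ref h w) FF.
case=> [w _|h0 [sh0 h00 ah0] h0pos].
  have [h Kh hw] := loc w.
  have : \forall w' \near w, 0 < Ref h w'.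
    exact: (@cvgr_gt R Omega (nbhs w) _ (Ref h) (Ref h w) (@Ref_continuous h w) 0 hw).
  move=> hpos; exists ([set w' | 0 < Ref h w'],
      [set h' | forall x, Ref h x <= Ref h' x]).
    by split=> //; exists h.
  by move=> [w' h'] /= [hw' hh']; apply: lt_le_trans hw' (hh' _).
have h0_gt0 w : 0 < Ref h0 w by apply: (h0pos h0).
have [w|g sg h0g] := selfadj_inv sh0; first by rewrite gt_eqF.
by have /eqP := a1; rewrite -h0g aM // ah0 mul0r eq_sym oner_eq0.
Qed.

End SymmetricFunctions.

(** * C*-extreme maps are multiplicative on self-adjoint functions *)

Section Determinants.
Variable R : realType.

Lemma horner_char_poly n (M : 'M[R]_n) r : (char_poly M).[r] = \det (r%:M - M).
Proof.
rewrite /char_poly -horner_evalE -det_map_mx; congr (\det _).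
apply/matrixP => i j; rewrite !mxE /= horner_evalE.
by rewrite hornerD hornerN hornerMn hornerX hornerC.
Qed.

Lemma poly_eq_large (p q : {poly R}) (c : R) :
  (forall r, c < r -> p.[r] = q.[r]) -> p = q.
Proof.
move=> pq; apply/eqP; rewrite -subr_eq0; apply/eqP.
pose rs := [seq c + i.+1%:R | i <- iota 0 (size (p - q))].
apply: (@roots_geq_poly_eq0 _ _ rs).
- apply/allP => _ /mapP[i _ ->]; rewrite rootE hornerD hornerN pq ?subrr //.
  by rewrite ltrDl ltr0n.
- rewrite map_inj_uniq ?iota_uniq // => i j /addrI /eqP.
  by rewrite eqr_nat eqSS => /eqP.
- by rewrite size_map size_iota.
Qed.

(** The characteristic polynomials agree at infinitely many points, and the trace is minus the
    coefficient of degree n - 1, which is where n > 0 enters. *)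
Lemma mxtrace_eq_of_det n (M N : 'M[R]_n) (c : R) : (0 < n)%N ->
  (forall r, c < r -> \det (r%:M - M) = \det (r%:M - N)) -> \tr M = \tr N.
Proof.
move=> n0 MN; apply: oppr_inj; rewrite -!char_poly_trace //; congr (_`_ _).
by congr polyseq; apply: (@poly_eq_large _ _ c) => r cr; rewrite !horner_char_poly MN.
Qed.

End Determinants.

Section CstarExtremePoints.
Variables (R : realType) (Omega : topologicalType).
Hypothesis Omega_compact : compact [set: Omega].
Variable bar : Omega -> Omega.

Local Notation A := (COmega R bar).
Implicit Types f g h : A.

Section Cut.
Variables (n : nat) (Phi : A -> 'M[R]_n).
Hypothesis Phi_UCP : UCP Phi.

Lemma UCP_pos h : mxpositive (Phi (smul (star h) h)).
Proof.
have [_ [cpPhi _] _] := Phi_UCP.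
have := cpPhi 1 (fun=> h) (fun=> 1%:M).
by rewrite !big_ord1 trmx1 mul1mx mulmx1.
Qed.

Lemma UCP_unit g (e : R) : 0 < e -> selfadj g -> (forall w, e <= Ref g w) ->
  Phi g \in unitmx.
Proof.
move=> e0 sg ge; apply: (@mxpositive_unit _ _ _ e) => //.
have [_ _ Phi1] := Phi_UCP.
have -> : Phi g - e%:M = Phi (g - e *: sone A).
  rewrite (linear_fB (UCP_linear Phi_UCP)) (linear_fZ (UCP_linear Phi_UCP)) Phi1.
  by rewrite scale_scalar_mx mulr1.
have [||h _ ->] := @selfadj_sqrt _ _ _ (g - e *: sone A); last exact: UCP_pos.
- by move=> w; rewrite ImfD ImfN ImfZ Imf1 sg mulr0 subr0.
- by move=> w; rewrite RefD RefN RefZ Ref1 mulr1 subr_ge0.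
Qed.

(** Conjugation by N^-1 makes f |-> Phi(g f) unital, and N becomes the coefficient of this piece in
    a decomposition of Phi. *)
Lemma UCP_cut g : selfadj g -> (forall w, 0 <= Ref g w) -> Phi g \in unitmx ->
  exists N, [/\ N^T = N, N *m N = Phi g, N \in unitmx &
    UCP (fun f => Ad (invmx N) (Phi (smul g f)))].
Proof.
move=> sg g0; have [h sh gE] := selfadj_sqrt sg g0 => gu.
have [linPhi [cpPhi starPhi] Phi1] := Phi_UCP.
have [N [symN NN _]] : exists N : 'M[R]_n, [/\ N^T = N, N *m N = Phi g &
    forall X, X *m Phi g = Phi g *m X -> X *m N = N *m X].
  by apply/psd_sqrt/psd_mxpositive; rewrite gE; apply: UCP_pos.
have Nu : N \in unitmx by move: gu; rewrite -NN unitmx_mul => /andP[].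
exists N; split=> //; split.
- apply: Ad_linear => c a b; rewrite -linPhi; congr Phi.
  exact: smul_linearr.
- split.
    (* Since g = h^2 with h self-adjoint, g a^* b = (h a)^* (h b), and the sum for the cut is a sum
       for Phi. *)
    apply: cp_sums_Ad => k a T; have [B BE] := cpPhi k (fun i => smul h (a i)) T.
    exists B; rewrite -BE; apply: eq_bigr => i _; apply: eq_bigr => j _.
    congr (_ *m Phi _ *m _); rewrite gE.
    by apply: csym_ext => w; rewrite !(RefM, ImfM, Ref_star, Imf_star) !sh; ring.
  move=> a; rewrite /Ad.
  have -> : smul g (star a) = star (smul g a).
    by apply: csym_ext => w; rewrite !(RefM, ImfM, Ref_star, Imf_star) sg; ring.
  by rewrite starPhi !trmx_mul trmxK mulmxA.
- by rewrite smul1r -NN /Ad trmx_inv symN mulmxA mulVmx // mul1mx mulmxV.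
Qed.

End Cut.

Variables (n : nat) (Phi : A -> 'M[R]_n).
Hypothesis Phi_ext : UCP_Cstar_ext Phi.

(** Phi is the sum of its cuts by g and 1 - g; the uniform bound e makes both coefficients
    invertible. Orthogonal equivalence of Phi with the first cut gives the formula, as det(U)^2 = 1
    and det(N)^2 = det Phi(g). *)
Lemma Cstar_ext_det g (e : R) f : 0 < e -> selfadj g ->
    (forall w, e <= Ref g w) -> (forall w, e <= 1 - Ref g w) ->
  \det (Phi (smul g f)) = \det (Phi g) * \det (Phi f).
Proof.
move=> e0 sg ge g1e; have [PhiU Phi_C] := Phi_ext.
have linPhi := UCP_linear PhiU; have [_ _ Phi1] := PhiU.
pose g' := sone A - g.
have sg' : selfadj g' by move=> w; rewrite ImfD ImfN Imf1 sg subr0.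
have g'E w : Ref g' w = 1 - Ref g w by rewrite RefD RefN Ref1.
have g'e w : e <= Ref g' w by rewrite g'E.
have [w|N [symN NN Nu NU]] := UCP_cut PhiU sg _ (UCP_unit PhiU e0 sg ge).
  exact: le_trans (ltW e0) (ge w).
have [w|N' [symN' NN' Nu' NU']] := UCP_cut PhiU sg' _ (UCP_unit PhiU e0 sg' g'e).
  exact: le_trans (ltW e0) (g'e w).
have [i|i||a|U [UU UU'] UE] := Phi_C 2
  (fun i f => if i == 0 then Ad (invmx N) (Phi (smul g f))
              else Ad (invmx N') (Phi (smul g' f)))
  (fun i => if i == 0 then N else N') _ _ _ _ ord0.
- by case: (i == 0).
- by case: (i == 0).
- rewrite !big_ord_recl big_ord0 /= addr0 symN symN' NN NN' -(linear_fD linPhi).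
  by rewrite addrC subrK.
- rewrite !big_ord_recl big_ord0 /= addr0 /Ad !trmx_inv symN symN'.
  rewrite !mulmxA !mulmxV // !mul1mx -!mulmxA !mulVmx // !mulmx1 -(linear_fD linPhi).
  by congr Phi; apply: csym_ext => w; rewrite !(RefM, ImfM, RefD, ImfD, RefN, ImfN, Ref1, Imf1); ring.
have detU : \det U * \det U = 1 by rewrite -[X in X * _]det_tr -det_mulmx UU det1.
rewrite (UE f) /= /Ad !det_mulmx !det_tr det_inv -NN det_mulmx.
have : \det N != 0 by move: Nu; rewrite unitmxE unitfE.
by move=> N0; field: detU.
Qed.

Lemma smulC f g : smul f g = smul g f.
Proof. by apply: csym_ext => w; rewrite !(RefM, ImfM); ring. Qed.

(* [(s - v)(s + v) = s^2 - v^2]: for large [s] multiplicativity of [det Phi] turns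
   this into equality of the characteristic polynomials of [Phi(v^2)] and
   [Phi(v)^2]; equal traces and the Schwarz inequality give the equality. *)
Lemma Cstar_ext_sqr v : (0 < n)%N -> selfadj v -> Phi (smul v v) = Phi v *m Phi v.
Proof.
move=> n0 sv; have [PhiU _] := Phi_ext; have linPhi := UCP_linear PhiU.
have [_ _ Phi1] := PhiU.
have [M vM] := Ref_bounded Omega_compact v.
have detE (s : R) : `|M| < s ->
    \det ((s ^+ 2)%:M - Phi (smul v v)) = \det ((s ^+ 2)%:M - Phi v *m Phi v).
  move=> Ms; have s0 : 0 < s by apply: le_lt_trans Ms.
  (* The factor c brings s - v into the range required of a cut: as |v| <= |M| < s, both c (s - v)
     and 1 - c (s - v) = c (3 s + v) are at least c (s - |M|). *)
  pose c := (4 * s)^-1; have c0 : 0 < c by rewrite invr_gt0 mulr_gt0.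
  have c4 : c * (4 * s) = 1 by rewrite mulVf ?gt_eqF ?mulr_gt0.
  pose g := c *: (s *: sone A - v).
  have gE w : Ref g w = c * (s - Ref v w).
    by rewrite RefZ RefD RefN RefZ Ref1 mulr1.
  have vb w : - `|M| <= Ref v w <= `|M|.
    by rewrite -ler_norml (le_trans (vM w)) ?ler_norm.
  have e0 : 0 < c * (s - `|M|) by rewrite mulr_gt0 // subr_gt0.
  have sg : selfadj g.
    by move=> w; rewrite ImfZ ImfD ImfN ImfZ Imf1 sv mulr0 subr0 mulr0.
  have ge w : c * (s - `|M|) <= Ref g w.
    by rewrite gE ler_pM2l // lerD2l lerN2; have /andP[] := vb w.
  have g1e w : c * (s - `|M|) <= 1 - Ref g w.
    by rewrite gE -c4 -mulrBr ler_pM2l //; have /andP[v1 v2] := vb w; lra.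
  have := Cstar_ext_det (s *: sone A + v) e0 sg ge g1e.
  have -> : smul g (s *: sone A + v) = c *: (s ^+ 2 *: sone A - smul v v).
    apply: csym_ext => w; rewrite !(RefM, ImfM, RefZ, ImfZ, RefD, ImfD, RefN, ImfN,
      RefM, ImfM, RefZ, ImfZ, Ref1, Imf1) sv; ring.
  rewrite /g !(linear_fZ linPhi) !(linear_fB linPhi) (linear_fD linPhi).
  rewrite !(linear_fZ linPhi) Phi1 !scale_scalar_mx !mulr1.
  rewrite !detZ -mulrA -det_mulmx mulmxBl !mulmxDr.
  rewrite !mul_scalar_mx !mul_mx_scalar.
  have -> : s *: s%:M + s *: Phi v - (s *: Phi v + Phi v *m Phi v) =
      (s ^+ 2)%:M - Phi v *m Phi v.
    by rewrite scale_scalar_mx -expr2; mx_ring.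
  by apply: mulfI; rewrite expf_neq0 ?gt_eqF.
have trE : \tr (Phi (smul v v)) = \tr (Phi v *m Phi v).
  apply: (@mxtrace_eq_of_det _ _ _ _ (`|M| ^+ 2)) => // r Mr.
  have r0 : 0 <= r by apply: le_trans (ltW Mr); rewrite sqr_ge0.
  rewrite -(sqr_sqrtr r0); apply: detE.
  by rewrite -(@ltr_pXn2r _ 2) ?nnegrE ?sqrtr_ge0 // sqr_sqrtr.
have starv := selfadj_star sv.
have vT : (Phi v)^T = Phi v by rewrite -(UCP_star PhiU) starv.
have := UCP_schwarz v PhiU; rewrite starv vT => /mxpositive_trace_eq0.
rewrite raddfB /= trE subrr => /(_ erefl)/eqP.
by rewrite subr_eq0 => /eqP.
Qed.

(** Multiplicativity on squares puts g in the multiplicative domain; the left-hand version follows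
    by taking adjoints. *)
Lemma Cstar_ext_mul f g : (0 < n)%N -> selfadj g ->
  Phi (smul f g) = Phi f *m Phi g /\ Phi (smul g f) = Phi g *m Phi f.
Proof.
move=> n0 sg; have [PhiU _] := Phi_ext.
have gg : Phi (smul (star g) g) = (Phi g)^T *m Phi g.
  by rewrite -(UCP_star PhiU) selfadj_star // Cstar_ext_sqr.
have fg := UCP_multiplicative_domain PhiU gg; split; first exact: fg.
have := congr1 trmx (fg (star f)).
rewrite trmx_mul -!(UCP_star PhiU) starK (selfadj_star sg) => <-.
by rewrite starM starK (selfadj_star sg).
Qed.

End CstarExtremePoints.

(** * Simultaneous diagonalization and perturbations *)

Section DiagonalMatrices.
Variables (R : realType) (n : nat).
Implicit Types u v : 'I_n -> R.

Definition dg u : 'M[R]_n := diag_mx (\row_i u i).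

Lemma dgE u i j : dg u i j = u i *+ (i == j).
Proof. by rewrite !mxE. Qed.

Lemma mul_dg u m (M : 'M[R]_(n, m)) i j : (dg u *m M) i j = u i * M i j.
Proof. by rewrite mul_diag_mx !mxE. Qed.

Lemma mul_mx_dg u m (M : 'M[R]_(m, n)) i j : (M *m dg u) i j = M i j * u j.
Proof. by rewrite mul_mx_diag !mxE. Qed.

Lemma dgT u : (dg u)^T = dg u.
Proof. exact: tr_diag_mx. Qed.

Lemma dgM u v : dg u *m dg v = dg (fun i => u i * v i).
Proof. by rewrite /dg mulmx_diag; congr diag_mx; apply/rowP => i; rewrite !mxE. Qed.

Lemma dgD u v : dg u + dg v = dg (fun i => u i + v i).
Proof. by apply/matrixP => i j; rewrite !mxE mulrnDl. Qed.

Lemma dgN u : - dg u = dg (fun i => - u i).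
Proof. by apply/matrixP => i j; rewrite !mxE mulNrn. Qed.

Lemma dgZ c u : c *: dg u = dg (fun i => c * u i).
Proof. by apply/matrixP => i j; rewrite !mxE mulrnAr. Qed.

Lemma dg1 : dg (fun=> 1) = 1%:M.
Proof. by apply/matrixP => i j; rewrite !mxE. Qed.

Lemma dg0 : dg (fun=> 0) = 0.
Proof. by apply/matrixP => i j; rewrite !mxE mul0rn. Qed.

Lemma eq_dg u v : u =1 v -> dg u = dg v.
Proof. by move=> uv; congr diag_mx; apply/rowP => i; rewrite !mxE. Qed.

Lemma mxpositive_dg u : (forall i, 0 <= u i) -> mxpositive (dg u).
Proof.
move=> u0; exists (dg (fun i => Num.sqrt (u i))); rewrite dgT dgM.
by apply: eq_dg => i; rewrite -expr2 sqr_sqrtr.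
Qed.

End DiagonalMatrices.

Section DiagonalForm.
Variables (R : realType) (Omega : topologicalType).
Hypothesis Omega_compact : compact [set: Omega].
Hypothesis Omega_hausdorff : hausdorff_space Omega.
Variable bar : Omega -> Omega.
Hypothesis bar_continuous : continuous bar.
Hypothesis bar_period2 : involutive bar.

Local Notation A := (COmega R bar).
Implicit Types f g h k : A.

(** The choice depends only on the orbit of w. With all points normalized in this way, two of them
    are in the same orbit exactly when they are equal. *)
Definition orbit_repr (w : Omega) : Omega := choose (pred2 w (bar w)) w.

Lemma orbit_reprP w : orbit_repr w = w \/ orbit_repr w = bar w.
Proof.
have : pred2 w (bar w) (orbit_repr w) by apply: chooseP; rewrite /= eqxx.
by move=> /orP[] /eqP ->; [left | right].
Qed.

Lemma orbit_repr_bar w : orbit_repr (bar w) = orbit_repr w.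
Proof.
rewrite /orbit_repr (@eq_choose _ _ (pred2 w (bar w))); last first.
  by move=> x; rewrite /= bar_period2 orbC.
by apply: choose_id; rewrite /= ?eqxx ?orbT.
Qed.

Lemma orbit_repr_id w : orbit_repr (orbit_repr w) = orbit_repr w.
Proof. by have [E|E] := orbit_reprP w; rewrite {1}E ?orbit_repr_bar. Qed.

Lemma orbit_repr_inj x y : orbit_repr x = x -> orbit_repr y = y ->
  x = y \/ x = bar y -> x = y.
Proof. by move=> xE yE [//|xy]; rewrite -xE xy orbit_repr_bar yE. Qed.

Lemma Ref_repr f w : Ref f (orbit_repr w) = Ref f w.
Proof. by have [->|->] := orbit_reprP w; rewrite ?Ref_bar. Qed.

Lemma Cstar_ext_diag n (Phi : A -> 'M[R]_n) : (0 < n)%N -> UCP_Cstar_ext Phi ->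
  exists Psi (w : 'I_n -> Omega), [/\ unitarily_equivalent Phi Psi,
    UCP_Cstar_ext Psi, forall i, orbit_repr (w i) = w i &
    forall g, selfadj g -> Psi g = dg (fun i => Ref g (w i))].
Proof.
move=> n0 Phi_ext; have [PhiU _] := Phi_ext; have linPhi := UCP_linear PhiU.
have [_ _ Phi1] := PhiU.
have mulPhi f g (sg : selfadj g) := Cstar_ext_mul Omega_compact Phi_ext f n0 sg.
have [||U [a [UU Ua]]] := @sym_family_diag R n {x : A | selfadj x} (fun x : {x : A | selfadj x} => Phi (sval x)).
- by move=> [g sg]; rewrite /= -(UCP_star PhiU) selfadj_star.
- move=> [g sg] [h sh] /=; have [<- gh] := mulPhi g h sh.
  by rewrite -gh smulC.
have UU' : U^T *m U = 1%:M by apply: mulmx1C.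
(* The diagonal entry is defined on the whole algebra, unlike [a i], and its restriction to
   self-adjoint functions is a character. *)
pose b i g := (U *m Phi g *m U^T) i i.
have UPhi g : selfadj g -> U *m Phi g *m U^T = dg (fun i => b i g).
  move=> sg; have := Ua (exist _ g sg) => /= UgE.
  have gE : U *m Phi g *m U^T = dg (fun i => a i (exist _ g sg)).
    by rewrite UgE -mulmxA UU mulmx1.
  by rewrite gE; apply: eq_dg => i; rewrite /b gE dgE eqxx.
have ex_pt i : exists w, forall g, selfadj g -> b i g = Ref g w.
  apply: (selfadj_character Omega_compact) => [g h sg sh|c g sg|g h sg sh|].
  - by rewrite /b (linear_fD linPhi) mulmxDr mulmxDl mxE.
  - by rewrite /b (linear_fZ linPhi) -scalemxAr -scalemxAl mxE.
  - have [ghE _] := mulPhi g h sh; rewrite /b ghE.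
    have -> : U *m (Phi g *m Phi h) *m U^T =
        (U *m Phi g *m U^T) *m (U *m Phi h *m U^T).
      by rewrite -!mulmxA (mulmxA U^T) UU' mul1mx.
    by rewrite UPhi // [in LHS]UPhi // mul_dg !dgE eqxx.
  - by rewrite /b Phi1 mulmx1 UU mxE eqxx.
have [w wE] := choice ex_pt.
exists (fun f => Ad U^T (Phi f)), (fun i => orbit_repr (w i)); split.
- by exists U^T => //; split; rewrite trmxK.
- by apply: UCP_Cstar_ext_Ad => //; split; rewrite trmxK.
- by move=> i; apply: orbit_repr_id.
- move=> g sg; rewrite /Ad trmxK UPhi //; apply: eq_dg => i.
  by rewrite wE // Ref_repr.
Qed.

Section Form.
Variables (n : nat) (w : 'I_n -> Omega).

Definition block_mx_of (S : 'M[R]_n) := forall i j, S i j != 0 -> w i = w j.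

Definition diag_form (S : 'M[R]_n) f : 'M[R]_n :=
  dg (fun i => Ref f (w i)) + S *m dg (fun i => Imf f (w i)).

Lemma block_mxC (u : Omega -> R) S : block_mx_of S ->
  S *m dg (fun i => u (w i)) = dg (fun i => u (w i)) *m S.
Proof.
move=> bS; apply/matrixP => i j; rewrite mul_mx_dg mul_dg mulrC.
have [->|/bS ->//] := eqVneq (S i j) 0; by rewrite !mulr0.
Qed.

(** Because S is skew, 1 + S^2 = 1 - S^T S, so the last hypothesis says that S is a contraction. *)
Lemma diag_form_UCP S : S^T = - S -> block_mx_of S -> mxpositive (1%:M + S *m S) ->
  UCP (diag_form S).
Proof.
move=> skewS bS posS; split.
- move=> c f g; rewrite /diag_form.
  apply/matrixP => i j; rewrite !(mxDE, mxZE, mul_mx_dg, dgE) !(RefD, ImfD, RefZ, ImfZ).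
  by case: (i == j); rewrite ?mulr1n ?mulr0n; ring.
- split=> [k a T|f]; last first.
    rewrite /diag_form trmxD trmx_mul !dgT skewS mulmxN -(block_mxC (Imf f)) //.
    rewrite -mulmxN dgN; congr (_ + _); last congr (_ *m _); apply: eq_dg => i.
      by rewrite Ref_star.
    by rewrite Imf_star.
  pose al i := dg (fun l => Ref (a i) (w l)); pose be i := dg (fun l => Imf (a i) (w l)).
  pose X := \sum_i (T i)^T *m al i; pose Y := \sum_i (T i)^T *m be i.
  have XT : X^T = \sum_i al i *m T i.
    rewrite /X linear_sum; apply: eq_bigr => i _.
    by rewrite /= trmx_mul trmxK dgT.
  have YT : Y^T = \sum_i be i *m T i.
    rewrite /Y linear_sum; apply: eq_bigr => i _.
    by rewrite /= trmx_mul trmxK dgT.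
  (* Completing the square: the sum equals X X^T + Y Y^T + X S Y^T - Y S X^T. *)
  have -> : \sum_(i < k) \sum_(j < k)
      (T i)^T *m diag_form S (smul (star (a i)) (a j)) *m T j =
      (Y + X *m S) *m (Y + X *m S)^T + X *m (1%:M + S *m S) *m X^T.
    rewrite trmxD trmx_mul skewS XT YT.
    transitivity (\sum_i \sum_j ((T i)^T *m be i + (T i)^T *m al i *m S) *m
        (be j *m T j - S *m (al j *m T j)) +
        \sum_i \sum_j ((T i)^T *m al i) *m (1%:M + S *m S) *m (al j *m T j)).
      rewrite -big_split; apply: eq_bigr => i _.
      rewrite -big_split; apply: eq_bigr => j _ /=.
      have -> : diag_form S (smul (star (a i)) (a j)) =
          al i *m al j + be i *m be j + al i *m S *m be j - be i *m S *m al j.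
        rewrite /al /be -!(block_mxC (Ref (a i)) bS) -!(block_mxC (Imf (a i)) bS).
        rewrite -!mulmxA !dgM -addrA -mulmxBr dgD dgN dgD.
        by congr (_ + S *m _); apply: eq_dg => l; rewrite ?RefM ?ImfM ?Ref_star ?Imf_star; ring.
      by mx_expand; mx_ring.
    have -> : Y + X *m S = \sum_i ((T i)^T *m be i + (T i)^T *m al i *m S).
      by rewrite /X /Y mulmx_suml -big_split.
    have -> : \sum_i be i *m T i + - S *m (\sum_i al i *m T i) =
        \sum_j (be j *m T j - S *m (al j *m T j)).
      by rewrite mulmx_sumr -big_split; apply: eq_bigr => j _; rewrite /= mulNmx.
    by rewrite /X !mulmx_suml; congr (_ + _); apply: eq_bigr => i _; rewrite mulmx_sumr.
  apply: mxpositiveD; first by rewrite -{1}[Y + _]trmxK; apply: mxpositive_tr.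
  by rewrite -{1}[X]trmxK; apply: mxpositive_mul.
- have Im0 : dg (fun i => Imf (sone A) (w i)) = 0.
    by rewrite -(dg0 R n); apply: eq_dg => i; rewrite Imf1.
  rewrite /diag_form Im0 mulmx0 addr0 -(dg1 R n).
  by apply: eq_dg => i; rewrite Ref1.
Qed.

End Form.

(** Odd functions vanish at real points, so [diag_form] does not determine S there. Requiring S to
    vanish there makes S the value of [diag_form] at [k0]. *)
Definition nonreal_block n (w : 'I_n -> Omega) (S : 'M[R]_n) :=
  forall i j, S i j != 0 -> w i = w j /\ w j <> bar (w j).

Lemma nonreal_blockW n (w : 'I_n -> Omega) S : nonreal_block w S -> block_mx_of w S.
Proof. by move=> bS i j /bS[]. Qed.

(** S is Psi(k0) for an odd k0 equal to 1 at every nonreal w_i; such a k0 exists because the w_i are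
    orbit representatives. *)
Lemma Cstar_ext_form n (Psi : A -> 'M[R]_n) (w : 'I_n -> Omega) :
    UCP_Cstar_ext Psi -> (forall i, orbit_repr (w i) = w i) ->
    (forall g, selfadj g -> Psi g = dg (fun i => Ref g (w i))) ->
  exists S k0, [/\ S^T = - S, nonreal_block w S, mxpositive (1%:M + S *m S),
    forall f, Psi f = diag_form w S f &
    skewadj k0 /\ forall i, w i <> bar (w i) -> Imf k0 (w i) = 1].
Proof.
move=> [PsiU Psi_C] repw Psi_sa; have linPsi := UCP_linear PsiU.
have [|k0 [sk k01]] := @skewadj_separate R Omega Omega_compact Omega_hausdorff bar
    bar_continuous bar_period2 [seq w i | i <- enum 'I_n & w i != bar (w i)].
  move=> _ _ /mapP[i _ ->] /mapP[j jn ->] wij.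
  move: jn; rewrite mem_filter => /andP[/eqP wj _].
  have wij' : w i = w j by apply: orbit_repr_inj => //; right.
  by apply: wj; rewrite -{1}wij'.
have k0E i : w i <> bar (w i) -> Imf k0 (w i) = 1.
  by move=> /eqP wi; apply/k01/mapP; exists i; rewrite // mem_filter wi mem_enum.
have skewP k : skewadj k -> (Psi k)^T = - Psi k.
  by move=> sk'; rewrite -(UCP_star PsiU) skewadj_star // linear_fN.
have schw k : skewadj k ->
    mxpositive (dg (fun i => Imf k (w i) ^+ 2) + Psi k *m Psi k).
  move=> sk'; have := UCP_schwarz k PsiU.
  rewrite -(UCP_star PsiU) skewadj_star // (linear_fN linPsi) mulNmx opprK.
  rewrite Psi_sa; last first.
    by move=> x; rewrite ImfM RefN ImfN sk' mulr0 addr0 oppr0 mul0r.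
  rewrite (@eq_dg _ _ _ (fun i => Imf k (w i) ^+ 2)) // => i.
  by rewrite RefM RefN ImfN sk'; ring.
(* Psi(k) is skew, so the j-th diagonal entry of [schw] bounds the squared norm of its j-th column
   by the square of [Imf k (w j)]. *)
have vanish k i j : skewadj k -> Imf k (w j) = 0 -> Psi k i j = 0.
  move=> sk' kj; have /psd_mxpositive[_ /(_ (delta_mx 0 j))] := schw k sk'.
  rewrite trmx_delta -mulmxA -colE -rowE !mxE eqxx kj expr0n /= mulr1n add0r.
  under eq_bigr => l _.
    have -> : Psi k j l = - Psi k l j by have /matrixP/(_ l j) := skewP k sk'; rewrite !mxE.
    rewrite mulNr -expr2; over.
  rewrite sumrN oppr_ge0 => le0.
  have /eqP : \sum_l Psi k l j ^+ 2 = 0.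
    by apply/le_anti; rewrite le0 sumr_ge0 // => l _; rewrite sqr_ge0.
  rewrite psumr_eq0 => [/allP/(_ i (mem_index_enum _))|l _]; last by rewrite sqr_ge0.
  by rewrite /= sqrf_eq0 => /eqP.
have real0 i j : w j = bar (w j) -> Psi k0 i j = 0.
  move=> wj; apply: vanish => //.
  have : Imf k0 (w j) = - Imf k0 (w j) by rewrite {1}wj Imf_bar.
  by move=> /eqP; rewrite -addr_eq0 -mulr2n mulrn_eq0 /= => /eqP.
(* The Schwarz inequality is an equality at g, so g lies in the multiplicative domain. Commutation
   with a g separating two points then annihilates the entries of S between them. *)
have commk g : selfadj g -> Psi k0 *m Psi g = Psi g *m Psi k0.
  move=> sg; have gg : Psi (smul (star g) g) = (Psi g)^T *m Psi g.
    rewrite -(UCP_star PsiU) selfadj_star // !Psi_sa //; last exact: selfadjM.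
    by rewrite dgM; apply: eq_dg => i; rewrite RefM sg mulr0 subr0.
  have kg := UCP_multiplicative_domain PsiU gg k0.
  have := congr1 trmx kg; rewrite trmx_mul (skewP _ sk) -kg -(UCP_star PsiU) starM.
  rewrite (skewadj_star sk) -(UCP_star PsiU) selfadj_star //.
  have -> : smul g (- k0) = - smul k0 g.
    by apply: csym_ext => x; rewrite !(RefM, ImfM, RefN, ImfN, RefM, ImfM); ring.
  by rewrite (linear_fN linPsi) mulmxN => /oppr_inj.
have blockS : nonreal_block w (Psi k0).
  move=> i j Sij; split; last by move=> /(real0 i)/eqP; rewrite (negbTE Sij).
  apply: contrapT => wij; have [|g [sg gi gj]] :=
      @selfadj_separate R Omega Omega_compact Omega_hausdorff bar
        bar_continuous bar_period2 [:: w i] [:: w j].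
    move=> x y; rewrite !inE => /eqP -> /eqP ->; split=> // wij'; apply: wij.
    by apply: orbit_repr_inj => //; right.
  have /matrixP/(_ i j) := commk g sg.
  rewrite (Psi_sa g sg) mul_dg mul_mx_dg (gi (w i)) ?(gj (w j)) ?mem_head // mulr0 mul1r.
  by move=> /esym/eqP; rewrite (negbTE Sij).
exists (Psi k0), k0; split=> //.
- exact: skewP.
(* The values of [Imf k0] at the w_i are 0 or 1, so the first summand is positive and the second is
   the Schwarz defect. *)
- have -> : 1%:M + Psi k0 *m Psi k0 = dg (fun i => 1 - Imf k0 (w i) ^+ 2) +
      (dg (fun i => Imf k0 (w i) ^+ 2) + Psi k0 *m Psi k0).
    by rewrite addrA dgD -(dg1 R n); congr (_ + _); apply: eq_dg => i; ring.
  apply: mxpositiveD (schw _ sk); apply: mxpositive_dg => i.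
  have [wi|/k0E ->] := pselect (w i = bar (w i)); last by rewrite expr1n subrr.
  have : Imf k0 (w i) = - Imf k0 (w i) by rewrite {1}wi Imf_bar.
  move=> /eqP; rewrite -addr_eq0 -mulr2n mulrn_eq0 /= => /eqP ->.
  by rewrite expr0n subr0.
- move=> f; have [g [k [sg sk' ->]]] := csym_decomp f.
  rewrite (linear_fD linPsi) Psi_sa // /diag_form.
  (* Column by column: k minus [Imf k (w j)] times k0 is odd and vanishes at w_j, whether w_j is
     real or not. *)
  have -> : Psi k = Psi k0 *m dg (fun i => Imf k (w i)).
    apply/matrixP => i j; rewrite mul_mx_dg mulrC; apply/eqP; rewrite -subr_eq0.
    have -> : Psi k i j - Imf k (w j) * Psi k0 i j = Psi (k - Imf k (w j) *: k0) i j.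
      by rewrite (linear_fB linPsi) (linear_fZ linPsi) mxDE mxNE mxZE.
    have skk : skewadj (k - Imf k (w j) *: k0).
      by move=> x; rewrite RefD RefN RefZ sk sk' mulr0 subr0.
    have [wj|wj] := pselect (w j = bar (w j)).
      have : Imf k (w j) = - Imf k (w j) by rewrite {1}wj Imf_bar.
      move=> /eqP; rewrite -addr_eq0 -mulr2n mulrn_eq0 /= => /eqP kj.
      by apply/eqP/vanish => //; rewrite ImfD ImfN ImfZ kj mul0r subr0.
    by apply/eqP/vanish => //; rewrite ImfD ImfN ImfZ k0E // mulr1 subrr.
  congr (_ + _); last congr (_ *m _); apply: eq_dg => i; rewrite ?RefD ?ImfD ?sk' ?sg ?addr0 ?add0r //.
Qed.

(* Orthogonally equivalent maps have equal Frobenius norms, so this is the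
   parallelogram identity applied to the values at [k0]. *)
Lemma Cstar_ext_rigid n (Psi : A -> 'M[R]_n) (w : 'I_n -> Omega) S H k0 :
    UCP_Cstar_ext Psi -> (forall f, Psi f = diag_form w S f) ->
    skewadj k0 -> (forall i, w i <> bar (w i) -> Imf k0 (w i) = 1) ->
    S^T = - S -> nonreal_block w S -> H^T = - H -> nonreal_block w H ->
    mxpositive (1%:M + (S + H) *m (S + H)) ->
    mxpositive (1%:M + (S - H) *m (S - H)) ->
  H = 0.
Proof.
move=> [PsiU Psi_C] PsiE sk k0E skewS bS skewH bH pos_add pos_sub.
have mulk0 M : nonreal_block w M -> diag_form w M k0 = M.
  move=> bM; apply/matrixP => i j; rewrite mxDE mul_mx_dg dgE sk mul0rn add0r.
  have [->|/bM[_ /k0E ->]] := eqVneq (M i j) 0; first by rewrite mul0r.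
  by rewrite mulr1.
have bD c : nonreal_block w (S + c *: H).
  move=> i j; rewrite mxDE mxZE; have [->|/bS //] := eqVneq (S i j) 0.
  by rewrite add0r mulf_eq0 negb_or => /andP[_ /bH].
have skewD c : (S + c *: H)^T = - (S + c *: H).
  by rewrite trmxD trmxZ skewS skewH; mx_ring.
(* Psi is the average of these two maps, that is, a decomposition with both coefficients equal to
   1/sqrt 2. *)
pose Psi_ (i : 'I_2) := diag_form w (S + (if i == 0 then 1 else -1) *: H).
have Psi_UCP i : UCP (Psi_ i).
  apply: diag_form_UCP; [exact: skewD|exact: nonreal_blockW|].
  by case: (i == 0); rewrite ?scale1r ?scaleN1r.
pose r : R := Num.sqrt 2^-1; have rr : r * r = 2^-1.
  by rewrite -expr2 sqr_sqrtr // invr_ge0 ler0n.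
have r0 : r != 0 by rewrite gt_eqF // sqrtr_gt0 invr_gt0 ltr0n.
have normE i : \tr (S^T *m S) = \tr ((Psi_ i k0)^T *m Psi_ i k0).
  have [i'|i'||a|U [UU UU'] UE] := Psi_C 2 Psi_ (fun=> r%:M) _ _ _ _ i.
  - exact: Psi_UCP.
  - by rewrite -scalemx1 unitmxZ ?unitmx1 // unitfE.
  - rewrite !big_ord_recl big_ord0 /= addr0 tr_scalar_mx -scalar_mxM rr.
    by rewrite -raddfD /=; congr (_%:M); field.
  - rewrite PsiE !big_ord_recl big_ord0 /= addr0 /Ad tr_scalar_mx.
    rewrite !mul_scalar_mx !mul_mx_scalar !scalerA rr /Psi_ /diag_form /=.
    by rewrite scale1r scaleN1r !mulmxDl; mx_expand; apply/matrixP => p q;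
       rewrite !(mxDE, mxNE, mxZE); field.
  have -> : S = U^T *m Psi_ i k0 *m U by rewrite -[S]mulk0 // -PsiE UE.
  rewrite !trmx_mul trmxK -!mulmxA (mulmxA U) UU' mul1mx.
  by rewrite mxtrace_mulC -!mulmxA UU' mulmx1.
have := normE 0; have := normE 1; rewrite /Psi_ !mulk0 //= scale1r scaleN1r => E1 E0.
apply: mxtrace_mul_tr_eq0; have : \tr ((S + H)^T *m (S + H)) + \tr ((S - H)^T *m (S - H))
    = \tr (S^T *m S) + \tr (S^T *m S) + (\tr (H^T *m H) + \tr (H^T *m H)).
  by rewrite -!raddfD /=; congr (\tr _); mx_expand; mx_ring.
by rewrite -E0 -E1; lra.
Qed.

Definition supported n (w : 'I_n -> Omega) x (u : 'rV[R]_n) :=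
  forall i, u 0 i != 0 -> w i = x.

Lemma supported_mul n (w : 'I_n -> Omega) x u S :
  block_mx_of w S -> supported w x u -> supported w x (u *m S).
Proof.
move=> bS su j; apply: contraNeq => /eqP wj; rewrite mxE big1 // => i _.
have [->|/su ui] := eqVneq (u 0 i) 0; first by rewrite mul0r.
have [->|/bS wij] := eqVneq (S i j) 0; first by rewrite mulr0.
by case: wj; rewrite -wij.
Qed.

Lemma supportedD n (w : 'I_n -> Omega) x u v :
  supported w x u -> supported w x v -> supported w x (u + v).
Proof.
move=> su sv i; rewrite mxDE; have [->|/su ->//] := eqVneq (u 0 i) 0.
by rewrite add0r => /sv.
Qed.

Lemma supportedZ n (w : 'I_n -> Omega) x c u :
  supported w x u -> supported w x (c *: u).
Proof. by move=> su i; rewrite mxZE mulf_eq0 negb_or => /andP[_ /su]. Qed.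

(* Otherwise [S] could be perturbed to [S +- e D (u^T v - v^T u) D]. *)
Lemma Cstar_ext_defect n (Psi : A -> 'M[R]_n) (w : 'I_n -> Omega) S k0 x u v :
    UCP_Cstar_ext Psi -> (forall f, Psi f = diag_form w S f) ->
    skewadj k0 -> (forall i, w i <> bar (w i) -> Imf k0 (w i) = 1) ->
    S^T = - S -> nonreal_block w S -> mxpositive (1%:M + S *m S) ->
    x <> bar x -> supported w x u -> supported w x v ->
  let D := 1%:M + S *m S in
  (u *m D)^T *m (v *m D) = (v *m D)^T *m (u *m D).
Proof.
move=> Psi_ext PsiE sk k0E skewS bS posS xn su sv D.
have DE : D = 1%:M + S *m S by [].
rewrite -DE in posS; clearbody D.
have symD : D^T = D by case/psd_mxpositive: posS.
have DS : D *m S = S *m D by rewrite DE mulmxDl mulmxDr mul1mx mulmx1 mulmxA.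
pose K := u^T *m v - v^T *m u.
have HE : D *m K *m D = (u *m D)^T *m (v *m D) - (v *m D)^T *m (u *m D).
  by rewrite /K !trmx_mul symD; mx_expand; mx_ring.
have skewK : K^T = - K by rewrite /K; mx_expand; mx_ring.
clearbody K.
pose Y1 := S *m K + K *m S; pose Y2 := K *m D *m D *m K.
have symY1 : Y1^T = Y1 by rewrite /Y1; mx_expand; rewrite skewS skewK; mx_expand; mx_ring.
have symY2 : Y2^T = Y2 by rewrite /Y2; mx_expand; rewrite skewK symD; mx_expand; mx_ring.
have [c1 c10 Y1b] := quadratic_form_bound Y1.
have [c2 c20 Y2b] := quadratic_form_bound Y2.
(* Then e <= 1 and 1 - e c1 - e^2 c2 >= 1 - e (c1 + c2) = e > 0. *)
pose e := (1 + c1 + c2)^-1.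
have e0 : 0 < e by rewrite invr_gt0; lra.
have e1 : e * (1 + c1 + c2) = 1 by rewrite mulVf // gt_eqF //; lra.
have pos_e (s : R) : `|s| = e -> mxpositive (1%:M + (S + s *: (D *m K *m D)) *m
    (S + s *: (D *m K *m D))).
  move=> sE; have ss : s ^+ 2 = e ^+ 2 by rewrite -[LHS]real_normK ?num_real // sE.
  (* This is why the perturbation is sandwiched between two factors D. As D commutes with S and D =
     S^T D S + D^2, all the change sits inside D (...) D, and positivity holds even where D is
     singular once 1 + s Y1 + s^2 Y2 is positive. *)
  have -> : 1%:M + (S + s *: (D *m K *m D)) *m (S + s *: (D *m K *m D)) =
      S^T *m D *m S + D^T *m (1%:M + s *: Y1 + s ^+ 2 *: Y2) *m D.
    have DD : D *m D = D - S^T *m D *m S.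
      by rewrite skewS !mulNmx opprK -DS -mulmxA {2}DE mulmxDr mulmx1.
    have SS : S *m S = D - 1%:M by rewrite DE addrC addKr.
    have SHE : S *m (D *m K *m D) = D *m S *m K *m D by rewrite !mulmxA DS.
    have HSE : D *m K *m D *m S = D *m K *m S *m D by rewrite -!mulmxA DS.
    rewrite symD !mulmxDr !mulmxDl mulmx1 -!scalemxAr -!scalemxAl SHE HSE DD SS.
    by rewrite /Y1 /Y2; mx_expand; mx_ring.
  apply: mxpositiveD; first exact: mxpositive_mul.
  apply: mxpositive_mul; apply/psd_mxpositive; split=> [|z].
    by rewrite !trmxD !trmxZ trmx1 symY1 symY2.
  rewrite !mulmxDr !mulmxDl mulmx1 -!scalemxAr -!scalemxAl !(mxDE, mxZE) ss.
  have := Y1b z; have := Y2b z; have := row_norm_ge0 z.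
  set N := (z *m z^T) 0 0; set y1 := (z *m Y1 *m _) 0 0; set y2 := (z *m Y2 *m _) 0 0.
  move=> N0 y2b y1b.
  have sy1 : - (e * (c1 * N)) <= s * y1.
    rewrite lerNl; apply: le_trans (ler_norm _) _; rewrite normrN normrM sE.
    by rewrite ler_wpM2l // ltW.
  have sy2 : - (e ^+ 2 * (c2 * N)) <= e ^+ 2 * y2.
    rewrite lerNl; apply: le_trans (ler_norm _) _; rewrite normrN normrM.
    by rewrite ger0_norm ?sqr_ge0 // ler_wpM2l ?sqr_ge0.
    have e_le1 : e <= 1 by rewrite /e invf_le1; lra.
  have ee : e ^+ 2 * (c2 * N) <= e * (c2 * N).
    by rewrite ler_wpM2r ?mulr_ge0 // expr2 ler_piMl // ltW.
  have : e * (1 + c1 + c2) * N = N by rewrite e1 mul1r.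
  have := mulr_ge0 (ltW e0) N0; nra.
have bsupp z : supported w x z -> supported w x (z *m D).
  move=> sz; rewrite DE mulmxDr mulmx1 mulmxA; apply: supportedD => //.
  by do 2!apply: supported_mul (nonreal_blockW bS) _.
suff /eqP : e *: (D *m K *m D) = 0.
  by rewrite scaler_eq0 gt_eqF //= HE subr_eq0 => /eqP.
apply: (Cstar_ext_rigid Psi_ext PsiE sk k0E skewS bS).
- by rewrite trmxZ !trmx_mul symD skewK; mx_expand; mx_ring.
- have rank1 (y z : 'rV[R]_n) i j : supported w x y -> supported w x z ->
      (y^T *m z) i j != 0 -> w i = x /\ w j = x.
    move=> sy sz; rewrite mxE big_ord1 mxE mulf_eq0 negb_or => /andP[/sy -> /sz ->].
    by [].
  move=> i j; rewrite HE mxZE mxDE mxNE mulf_eq0 negb_or => /andP[_].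
  have wE : w i = x /\ w j = x -> w i = w j /\ w j <> bar (w j) by move=> [-> ->].
  have [-> |/rank1 h _] := eqVneq (((u *m D)^T *m (v *m D)) i j) 0.
    by rewrite sub0r oppr_eq0 => /rank1 h; apply/wE/h; apply: bsupp.
  by apply/wE/h; apply: bsupp.
- by apply: pos_e; rewrite gtr0_norm.
- by rewrite -scaleNr; apply: pos_e; rewrite normrN gtr0_norm.
Qed.

End DiagonalForm.

(** * Decomposition into blocks *)

Section StackedFrames.
Variable R : realType.

Lemma mxcol_mul_tr n k l (d : 'I_k -> nat) (d' : 'I_l -> nat)
    (B : forall i, 'M[R]_(d i, n)) (C : forall i, 'M[R]_(d' i, n)) :
  (forall i j, B i *m (C j)^T = 0) -> (\mxcol_i B i) *m (\mxcol_i C i)^T = 0.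
Proof.
move=> BC; rewrite tr_mxcol mul_mxcol_mxrow -[RHS]mxblock0.
by apply/eq_mxblock => i j.
Qed.

Lemma mxcol_orthonormal n k (d : 'I_k -> nat) (B : forall i, 'M[R]_(d i, n)) :
    (forall i, B i *m (B i)^T = 1%:M) ->
    (forall i j, i != j -> B i *m (B j)^T = 0) ->
  (\mxcol_i B i) *m (\mxcol_i B i)^T = 1%:M.
Proof.
move=> B1 B0; rewrite tr_mxcol mul_mxcol_mxrow -(mxdiagZ 1) /mxdiag.
apply/eq_mxblock => i j; case: eqVneq => [<-|/B0 //].
by rewrite B1 conform_mx_id.
Qed.

Lemma mxcol_intertwine n k (d : 'I_k -> nat) (B : forall i, 'M[R]_(d i, n))
    (M : forall i, 'M[R]_(d i)) (X : 'M[R]_n) :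
    (forall i, B i *m X = M i *m B i) ->
  (\mxcol_i B i) *m X = (\mxdiag_i M i) *m (\mxcol_i B i).
Proof.
by move=> BX; rewrite mxcol_mul mul_mxdiag_mxcol; apply/eq_mxcol.
Qed.

Lemma frame_unitarily_equivalent (A : realStarAlg R) d n (e : d = n)
    (W : 'M[R]_(d, n)) (Phi : A -> 'M[R]_n) (M : A -> 'M[R]_d) :
    W *m W^T = 1%:M -> (forall a, W *m Phi a = M a *m W) ->
  unitarily_equivalent Phi (castmap e M).
Proof.
case: n / e W Phi => W Phi WW WE; exists W^T.
  by split; rewrite trmxK //; apply: mulmx1C.
by move=> a; rewrite /castmap castmx_id /Ad trmxK WE -mulmxA WW mulmx1.
Qed.

End StackedFrames.

Section Blocks.
Variables (R : realType) (Omega : topologicalType).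
Hypothesis Omega_compact : compact [set: Omega].
Hypothesis Omega_hausdorff : hausdorff_space Omega.
Variable bar : Omega -> Omega.
Hypothesis bar_continuous : continuous bar.
Hypothesis bar_period2 : involutive bar.

Local Notation A := (COmega R bar).
Implicit Types f g h : A.

Variables (n : nat) (Psi : A -> 'M[R]_n) (w : 'I_n -> Omega) (S : 'M[R]_n) (k0 : A).
Hypothesis Psi_ext : UCP_Cstar_ext Psi.
Hypothesis PsiE : forall f, Psi f = diag_form w S f.
Hypothesis k0_skew : skewadj k0.
Hypothesis k0E : forall i, w i <> bar (w i) -> Imf k0 (w i) = 1.
Hypothesis S_skew : S^T = - S.
Hypothesis S_block : nonreal_block bar w S.
Hypothesis S_contr : mxpositive (1%:M + S *m S).
Hypothesis w_repr : forall i, orbit_repr bar (w i) = w i.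

Lemma Psi_k0 : Psi k0 = S.
Proof.
apply/matrixP => i j; rewrite PsiE mxDE mul_mx_dg dgE k0_skew mul0rn add0r.
have [->|/S_block[_ /k0E ->]] := eqVneq (S i j) 0; first by rewrite mul0r.
by rewrite mulr1.
Qed.

Lemma Psi_selfadj g : selfadj g -> Psi g = dg (fun i => Ref g (w i)).
Proof.
move=> sg; rewrite PsiE /diag_form.
have -> : dg (fun i => Imf g (w i)) = 0.
  by rewrite -(dg0 R n); apply: eq_dg => i; rewrite sg.
by rewrite mulmx0 addr0.
Qed.

Lemma supported_dg x (u : 'rV[R]_n) (a : Omega -> R) : supported w x u ->
  u *m dg (fun i => a (w i)) = a x *: u.
Proof.
move=> su; apply/rowP => i; rewrite mul_mx_dg mxZE.
by have [->|/su ->] := eqVneq (u 0 i) 0; rewrite ?mul0r ?mulr0 // mulrC.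
Qed.

Lemma supported_Psi x (u : 'rV[R]_n) f : supported w x u ->
  u *m Psi f = Ref f x *: u + Imf f x *: (u *m S).
Proof.
move=> su; have suS := supported_mul (nonreal_blockW S_block) su.
by rewrite PsiE mulmxDr mulmxA (supported_dg (Ref f) su) (supported_dg (Imf f) suS).
Qed.

(** Where v S^2 = -v, the plane spanned by v and v S is invariant and S acts on it as a quarter
    turn; in this basis it carries Pi_x. *)
Definition frame (c : summand) (v : 'rV[R]_n) : 'M[R]_(summand_dim c, n) :=
  match c with
  | Srho => v
  | _ => col_mx v (v *m S) : 'M[R]_(1 + 1, n)
  end.

(** The clause v S = 0 makes v a fixed vector of 1 + S^2, which [block_rho_unique] uses. *)
Definition block x c (v : 'rV[R]_n) :=
  [/\ orbit_repr bar x = x /\ supported w x v,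
      x = bar x -> c = Srho,
      x <> bar x -> c = Srho -> v *m S = 0,
      frame c v *m (frame c v)^T = 1%:M &
      forall f, frame c v *m Psi f = summand_map x c f *m frame c v].

Lemma row_skew0 (v : 'rV[R]_n) : v *m S *m v^T = 0.
Proof.
have /matrixP/(_ 0 0) : (v *m S *m v^T)^T = - (v *m S *m v^T).
  by rewrite !trmx_mul trmxK S_skew mulNmx mulmxN mulmxA.
rewrite mxE mxNE => /eqP; rewrite -addr_eq0 -mulr2n mulrn_eq0 /= => /eqP vSv.
by apply/matrixP => i j; rewrite !ord1 vSv mxE.
Qed.

(** Since S is skew, z S is orthogonal to z; being also parallel to z, it vanishes. *)
Lemma parallel_skew0 (z : 'rV[R]_n) : z != 0 ->
  z^T *m (z *m S) = (z *m S)^T *m z -> z *m S = 0.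
Proof.
move=> zn0 par; have : (z *m z^T) *m (z *m S) = 0.
  rewrite -mulmxA par trmx_mul S_skew; mx_expand.
  by rewrite row_skew0 mul0mx oppr0.
rewrite [z *m z^T]mx11_scalar mul_scalar_mx => /eqP.
rewrite scaler_eq0 => /orP[/eqP/row_norm_eq0/eqP|/eqP //].
by rewrite (negbTE zn0).
Qed.

(** V will be the orthogonal complement of the blocks already found. A function separating one point
    x from the others cuts v down to a vector u over x. For x nonreal put z = u (1 + S^2). If z = 0,
    then u S^2 = -u and u spans a Pi block with u S. Otherwise [Cstar_ext_defect], applied to u and
    u S, makes z and z S parallel, so z S = 0 and z spans a rho block. *)
Lemma exists_block (V : 'rV[R]_n -> Prop) (v : 'rV[R]_n) :
    (forall u u', V u -> V u' -> V (u + u')) -> (forall c u, V u -> V (c *: u)) ->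
    (forall f u, V u -> V (u *m Psi f)) -> V v -> v != 0 ->
  exists x c z, [/\ block x c z, V z & V (z *m S)].
Proof.
move=> VD VZ VP Vv vn0.
have VS u : V u -> V (u *m S) by rewrite -Psi_k0; apply: VP.
have [i vi] : exists i, v 0 i != 0.
  apply: contrapT => v0; move/eqP: vn0; apply; apply/rowP => i; rewrite mxE.
  by apply/eqP; apply: contrapT => /negP vi; apply: v0; exists i.
pose x := w i; have xr : orbit_repr bar x = x by apply: w_repr.
have [|g [sg gx gw]] := @selfadj_separate R Omega Omega_compact Omega_hausdorff bar
    bar_continuous bar_period2 [:: x] [seq w l | l <- enum 'I_n & w l != x].
  move=> _ _ /[!inE]/eqP -> /mapP[l lx ->]; move: lx; rewrite mem_filter.
  move=> /andP[/eqP lx _]; split=> xl; apply: lx; first by [].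
  by apply/esym/(orbit_repr_inj bar_period2) => //; right.
pose u := v *m Psi g; have Vu : V u by apply: VP.
have uE l : u 0 l = v 0 l * Ref g (w l) by rewrite /u Psi_selfadj // mul_mx_dg.
have su : supported w x u.
  move=> l; apply: contraNeq => lx; rewrite uE gw ?mulr0 //.
  by apply/mapP; exists l; rewrite // mem_filter lx mem_enum.
have un0 : u != 0.
  apply: contraNneq vi => /rowP/(_ i).
  by rewrite uE gx ?mem_head // mulr1 mxE => ->.
have scaled (c : R) z : V z -> V (c *: z) /\ V (c *: z *m S).
  by move=> Vz; split; [exact: VZ | apply/VS/VZ].
have [xreal|xn] := pselect (x = bar x).
  have [c c0 cu] := normalize un0; exists x, Srho, (c *: u).
  have [? ?] := scaled c u Vu; split=> //; split=> //.
  - by split=> //; apply: supportedZ.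
  - move=> f; have f0 : Imf f x = 0.
      have : Imf f x = - Imf f x by rewrite {1}xreal Imf_bar.
      by move=> /eqP; rewrite -addr_eq0 -mulr2n mulrn_eq0 /= => /eqP.
    rewrite /= (supported_Psi (x := x)); last exact: supportedZ.
    by rewrite f0 scale0r addr0 mul_scalar_mx.
have suS : supported w x (u *m S) by apply: supported_mul (nonreal_blockW S_block) su.
have := Cstar_ext_defect Psi_ext PsiE k0_skew k0E S_skew S_block S_contr xn su suS.
set D := 1%:M + S *m S => /= par.
pose z := u *m D.
have zS : u *m S *m D = z *m S.
  by rewrite /z /D !mulmxDr !mulmxDl !mulmx1 !mulmxA.
have [z0|zn0] := eqVneq z 0.
  have uSS : u *m S *m S = - u.
    by apply/eqP; rewrite -addr_eq0 addrC -mulmxA -{1}[u]mulmx1 -mulmxDr -/D -/z z0.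
  have [c c0 cu] := normalize un0; set a := c *: u in cu.
  have aSS : a *m S *m S = - a by rewrite /a -!scalemxAl uSS scalerN.
  have sa : supported w x a by apply: supportedZ.
  have saS : supported w x (a *m S) by apply: supported_mul (nonreal_blockW S_block) sa.
  exists x, SPi, a; have [? ?] := scaled c u Vu; split=> //; split=> //.
  - rewrite -[LHS]/((col_mx a (a *m S)) *m (col_mx a (a *m S))^T).
    rewrite tr_col_mx mul_col_row cu row_skew0 trmx_mul S_skew mulNmx mulmxN.
    rewrite !mulmxA row_skew0 oppr0 mulmxN !mulmxA aSS mulNmx opprK cu.
    by rewrite -scalar_mx_block.
  - move=> f; rewrite -[LHS]/((col_mx a (a *m S)) *m Psi f).
    rewrite -[RHS]/(block_mx (Ref f x)%:M (Imf f x)%:M (- Imf f x)%:M (Ref f x)%:M *m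
      col_mx a (a *m S)).
    rewrite mul_col_mx (supported_Psi _ sa) (supported_Psi _ saS) aSS.
    rewrite mul_block_col !mul_scalar_mx scalerN scaleNr.
    by rewrite (addrC (- _)) addrC.
have zS0 : z *m S = 0 by apply: parallel_skew0 => //; rewrite -zS.
have Vz : V z.
  by rewrite /z /D mulmxDr mulmx1 mulmxA; apply: VD Vu (VS _ (VS _ Vu)).
have sz : supported w x z.
  rewrite /z /D mulmxDr mulmx1 mulmxA; apply: supportedD => //.
  exact: supported_mul (nonreal_blockW S_block) suS.
have [c c0 cz] := normalize zn0; exists x, Srho, (c *: z).
have [? ?] := scaled c z Vz; split=> //; split=> //.
- by split=> //; apply: supportedZ.
- by move=> _ _; rewrite -scalemxAl zS0 scaler0.
- move=> f; rewrite /= (supported_Psi (x := x)); last exact: supportedZ.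
  by rewrite -scalemxAl zS0 scaler0 scaler0 addr0 mul_scalar_mx.
Qed.

(** Both vectors are fixed by 1 + S^2, so [Cstar_ext_defect] makes them parallel; orthogonal unit
    vectors are not. *)
Lemma block_rho_unique x (u v : 'rV[R]_n) : x <> bar x ->
  block x Srho u -> block x Srho v -> u *m v^T <> 0.
Proof.
move=> xn [[_ su] _ /(_ xn erefl) uS uu _] [[_ sv] _ /(_ xn erefl) vS vv _] uv.
have := Cstar_ext_defect Psi_ext PsiE k0_skew k0E S_skew S_block S_contr xn su sv.
have fixD (z : 'rV[R]_n) : z *m S = 0 -> z *m (1%:M + S *m S) = z.
  by move=> zS; rewrite mulmxDr mulmx1 mulmxA zS mul0mx addr0.
rewrite /= !fixD // => par.
have : u *m (v^T *m u) = 0 by rewrite mulmxA uv mul0mx.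
rewrite -par mulmxA => uuv.
rewrite /= in vv; have v0 : v = 0.
  rewrite -[v]mul1mx; have -> : 1%:M = u *m u^T by [].
  exact: uuv.
move/matrixP/(_ 0 0)/eqP: vv.
by rewrite v0 mul0mx !mxE eqxx eq_sym oner_eq0.
Qed.

Record block_family k (x : 'I_k -> Omega) (c : 'I_k -> summand)
    (v : 'I_k -> 'rV[R]_n) : Prop := BlockFamily {
  family_block : forall i, block (x i) (c i) (v i);
  family_orth : forall i j, i != j -> frame (c i) (v i) *m (frame (c j) (v j))^T = 0 }.

(** The induction asks for total dimension at least m, not exactly m, because a new block may add 2.
    Orthonormality gives the bound by n. *)
Lemma exists_block_family : exists k x c v,
  @block_family k x c v /\ (\sum_i summand_dim (c i))%N = n.
Proof.
suff ex m : (m <= n)%N -> exists k x c v,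
    @block_family k x c v /\ (m <= \sum_i summand_dim (c i))%N.
  have [k [x [c [v [fam le_n]]]]] := ex n (leqnn n).
  exists k, x, c, v; split=> //; apply/eqP; rewrite eqn_leq le_n andbT.
  apply: (@orthonormal_leq R _ _ (\mxcol_i frame (c i) (v i))).
  apply: mxcol_orthonormal => [i|]; last exact: family_orth fam.
  by have [] := family_block fam i.
elim: m => [_|m IH mn].
  have ord0T (T : Type) : 'I_0 -> T by case.
  exists 0, (ord0T _), (ord0T _), (ord0T _); split=> //.
  by split; case.
have [k [x [c [v [fam le_m]]]]] := IH (ltnW mn).
have [le_m1|] := leqP m.+1 (\sum_i summand_dim (c i)).
  by exists k, x, c, v.
rewrite ltnS => ge_m; pose F i := frame (c i) (v i); pose W := \mxcol_i F i.
have WW : W *m W^T = 1%:M.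
  apply: mxcol_orthonormal => [i|]; last exact: family_orth fam.
  by have [] := family_block fam i.
have /rowV0Pn[u /sub_kermxP uW un0] := orthonormal_compl WW (leq_ltn_trans ge_m mn).
have [|||y [d [z [zblock zW zSW]]]] := @exists_block (fun u => u *m W^T = 0) u _ _ _ uW un0.
- by move=> a b aW bW; rewrite mulmxDl aW bW addr0.
- by move=> b a aW; rewrite -scalemxAl aW scaler0.
- move=> f a aW; have [PsiU _] := Psi_ext.
  have WE : W *m Psi (star f) = (\mxdiag_i summand_map (x i) (c i) (star f)) *m W.
    by apply: mxcol_intertwine => i; have [] := family_block fam i.
  rewrite -mulmxA -[Psi f]trmxK -(UCP_star PsiU) -trmx_mul WE trmx_mul mulmxA.
  by rewrite aW mul0mx.
have Fz i : F i *m (frame d z)^T = 0.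
  have colF (a : 'rV_n) : a *m W^T = 0 -> F i *m a^T = 0.
    rewrite /W tr_mxcol mul_mxrow => /(congr1 (fun M => submxrow M i)).
    by rewrite mxrowK submxrow0 => /(congr1 trmx); rewrite trmx_mul trmxK trmx0.
  have col2 : F i *m (col_mx z (z *m S))^T = 0.
    by rewrite tr_col_mx mul_mx_row !colF // row_mx0.
  by case: d {zblock} => //; apply: colF.
pose X (T : Type) (a : 'I_k -> T) (b : T) (i : 'I_(1 + k)) :=
  match fintype.split i with inl _ => b | inr j => a j end.
exists (1 + k)%N, (X _ x y), (X _ c d), (X _ v z); split; last first.
  rewrite big_split_ord /= big_ord1 /X.
  under eq_bigr => i _ do rewrite (unsplitK (inr i)).
  rewrite (unsplitK (inl ord0)); apply: leq_ltn_trans le_m _.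
  by rewrite -addn1 addnC leq_add2r; case: d {zblock Fz}.
split=> [i|i j]; first by rewrite /X; case: (fintype.split i) => // ?; case: fam.
rewrite -(can_eq splitK) /X; case: (fintype.split i) (fintype.split j) => i' [j'|j'].
- by rewrite !ord1 eqxx.
- by move=> _; apply: trmx_inj; rewrite trmx_mul trmxK Fz trmx0.
- by move=> _; apply: Fz.
- by move=> ij; apply: (family_orth fam); apply: contraNneq ij => ->.
Qed.

End Blocks.

(** * C*-extreme maps have a normal form *)

Section CastFrames.
Variables (R : realType) (n d d' : nat) (e : d = d') (W : 'M[R]_(d, n)).

Lemma castmx_orthonormal : W *m W^T = 1%:M ->
  castmx (e, erefl n) W *m (castmx (e, erefl n) W)^T = 1%:M.
Proof. by case: d' / e; rewrite castmx_id. Qed.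

Lemma castmx_mul0 m (C : 'M[R]_(n, m)) : W *m C = 0 ->
  castmx (e, erefl n) W *m C = 0.
Proof. by case: d' / e; rewrite castmx_id. Qed.

Lemma castmx_intertwine (A : realStarAlg R) (M : A -> 'M[R]_d) a (X : 'M[R]_n) :
  W *m X = M a *m W ->
  castmx (e, erefl n) W *m X = castmap e M a *m castmx (e, erefl n) W.
Proof. by case: d' / e; rewrite /castmap !castmx_id. Qed.

End CastFrames.

Section NormalForm.
Variables (R : realType) (Omega : topologicalType).
Hypothesis Omega_compact : compact [set: Omega].
Hypothesis Omega_hausdorff : hausdorff_space Omega.
Variable bar : Omega -> Omega.
Hypothesis bar_continuous : continuous bar.
Hypothesis bar_period2 : involutive bar.

Local Notation A := (COmega R bar).

Definition normal_form n (Phi : A -> 'M[R]_n) :=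
  exists (p q : nat) (xi : 'I_p -> Omega) (eta : 'I_q -> Omega)
         (n_ : 'I_p -> nat) (m_ : 'I_q -> nat)
         (Phi_xi : forall j, COmega R bar -> 'M[R]_(n_ j))
         (Phi_eta : forall j, COmega R bar -> 'M[R]_(m_ j))
         (dimE : (\sum_(j < p) n_ j + \sum_(j < q) m_ j)%N = n),
    [/\ injective xi, injective eta & forall i j, xi i <> eta j] /\
    (forall j, xi j = bar (xi j)) /\
    (forall i, eta i <> bar (eta i)) /\
    (forall i j, i != j -> eta i <> bar (eta j)) /\
    (forall j, (0 < n_ j)%N) /\ (forall j, (0 < m_ j)%N) /\
    (forall j, Phi_xi j = rho_copies (xi j) (n_ j)) /\
    (forall j, in_E (eta j) (Phi_eta j)) /\
    unitarily_equivalent Phi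
      (castmap dimE (dsum2 (dsum Phi_xi) (dsum Phi_eta))).

(** The blocks are regrouped by their point: over a real point all are rho, over a nonreal point at
    most one is. Stacking the frames in this order gives the orthogonal change of basis. *)
Theorem Cstar_ext_normal_form n (Phi : A -> 'M[R]_n) : (0 < n)%N ->
  UCP_Cstar_ext Phi -> normal_form Phi.
Proof.
move=> n0 Phi_ext.
have [Psi [w [PhiPsi Psi_ext wr Psi_sa]]] :=
  Cstar_ext_diag Omega_compact bar_period2 n0 Phi_ext.
have [S [k0 [S_skew S_block S_contr PsiE [k0_skew k0E]]]] :=
  Cstar_ext_form Omega_compact Omega_hausdorff bar_continuous bar_period2
    Psi_ext wr Psi_sa.
have [k [x [c [v [[fam_block fam_orth] dimE]]]]] :=
  exists_block_family Omega_compact Omega_hausdorff bar_continuous bar_period2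
    Psi_ext PsiE k0_skew k0E S_skew S_block S_contr wr.
pose F t := frame S (c t) (v t).
have F1 t : F t *m (F t)^T = 1%:M by have [] := fam_block t.
have FE t f : F t *m Psi f = summand_map (x t) (c t) f *m F t.
  by have [] := fam_block t.
have c_real t : x t = bar (x t) -> c t = Srho by have [] := fam_block t.
have xr t : orbit_repr bar (x t) = x t by have [[]] := fam_block t.
(* The points that occur, listed once each, real ones apart from nonreal ones; multiplicities are
   recovered as the fibres [fib] of [cls]. *)
pose xs := in_tuple (undup [seq x t | t <- enum 'I_k & x t == bar (x t)]).
pose ys := in_tuple (undup [seq x t | t <- enum 'I_k & x t != bar (x t)]).
pose xi j := tnth xs j; pose eta j := tnth ys j.
have xi_inj : injective xi by apply/tuple_uniqP/undup_uniq.
have eta_inj : injective eta by apply/tuple_uniqP/undup_uniq.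
have xiP j : exists2 t, x t = xi j & x t = bar (x t).
  have := mem_tnth j xs; rewrite mem_undup => /mapP[t tx xiE].
  by exists t => //; move: tx; rewrite mem_filter => /andP[/eqP].
have etaP j : exists2 t, x t = eta j & x t <> bar (x t).
  have := mem_tnth j ys; rewrite mem_undup => /mapP[t tx etaE].
  by exists t => //; move: tx; rewrite mem_filter => /andP[/eqP].
have xi_bar j : xi j = bar (xi j) by have [t <-] := xiP j.
have eta_bar j : eta j <> bar (eta j) by have [t <-] := etaP j.
have xi_eta i j : xi i <> eta j.
  by move=> xieta; apply: (eta_bar j); rewrite -xieta.
pose pt (z : 'I_(size xs) + 'I_(size ys)) := match z with inl j => xi j | inr j => eta j end.
have pt_inj : injective pt.
  move=> [i|i] [j|j] //= => [/xi_inj ->|/xi_eta//|/esym/xi_eta//|/eta_inj ->] //.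
have cls_ex t : exists z, x t = pt z.
  have [xt|xt] := eqVneq (x t) (bar (x t)).
    have /tnthP[j jE] : x t \in xs.
      by rewrite mem_undup; apply/mapP; exists t => //; rewrite mem_filter mem_enum andbT; apply/eqP.
    by exists (inl j).
  have /tnthP[j jE] : x t \in ys.
    by rewrite mem_undup; apply/mapP; exists t; rewrite // mem_filter xt mem_enum.
  by exists (inr j).
have [cls clsE] := choice cls_ex.
pose fib z := [pred t | cls t == z].
have fibE z (l : 'I_#|fib z|) : x (enum_val l) = pt z.
  by have := enum_valP l; rewrite inE clsE => /eqP ->.
have fib_gt0 z t : x t = pt z -> (0 < #|fib z|)%N.
  by move=> xz; apply/card_gt0P; exists t; rewrite inE; apply/eqP/pt_inj; rewrite -clsE.
pose n_ j := #|fib (inl j)|; pose B_eta j (l : 'I_#|fib (inr j)|) := F (enum_val l).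
pose m_ j := (\sum_(l < #|fib (inr j)|) summand_dim (c (enum_val l)))%N.
have c_xi j (l : 'I_(n_ j)) : c (enum_val l) = Srho.
  by apply: c_real; rewrite fibE /= -xi_bar.
have dimE' : (\sum_j n_ j + \sum_j m_ j)%N = n.
  rewrite -dimE (partition_big cls xpredT) //= big_sumType /=.
  congr (_ + _)%N; apply: eq_bigr => j _.
    rewrite /n_ -sum1_card; apply: eq_big => [t|t tj]; first by rewrite inE.
    by rewrite c_real // clsE (eqP tj) /= -xi_bar.
  by rewrite /m_ -(big_enum_val (fun t => summand_dim (c t))); apply: eq_bigl => t; rewrite inE.
pose Phi_xi j : A -> 'M[R]_(n_ j) := rho_copies (xi j) (n_ j).
pose M_eta j (l : 'I_#|fib (inr j)|) : A -> 'M[R]_(summand_dim (c (enum_val l))) :=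
  summand_map (eta j) (c (enum_val l)).
pose Phi_eta j : A -> 'M[R]_(m_ j) := dsum (M_eta j).
have v1 j (l : 'I_(n_ j)) : v (enum_val l) *m (v (enum_val l))^T = 1%:M.
  by have := F1 (enum_val l); rewrite /F c_xi.
have v0 j (l : 'I_(n_ j)) t : enum_val l != t -> v (enum_val l) *m (F t)^T = 0.
  by move=> /fam_orth; rewrite c_xi.
have v00 i j (l : 'I_(n_ i)) (l' : 'I_(n_ j)) : enum_val l != enum_val l' ->
    v (enum_val l) *m (v (enum_val l'))^T = 0.
  by move=> /v0; rewrite /F c_xi.
have vE j (l : 'I_(n_ j)) f :
    v (enum_val l) *m Psi f = rho (xi j) f *m v (enum_val l).
  by have := FE (enum_val l) f; rewrite /F c_xi fibE.
(* The rows [v] replace [frame] here, whose height depends on [c]; this height matches that of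
   [rho_copies] before its cast. *)
pose V_xi j : 'M[R]_(\sum_(l < n_ j) 1, n) := \mxcol_(l < n_ j) v (enum_val l).
pose W_xi j := castmx (sum1_ord (n_ j), erefl n) (V_xi j).
pose W_eta j : 'M[R]_(m_ j, n) := \mxcol_l B_eta j l.
have fib_neq z z' (l : 'I_#|fib z|) (l' : 'I_#|fib z'|) : z != z' ->
    enum_val l != enum_val l'.
  apply: contraNneq => ll'; have := enum_valP l; have := enum_valP l'.
  by rewrite !inE -ll' => /eqP -> /eqP ->.
pose W := col_mx (\mxcol_j W_xi j) (\mxcol_j W_eta j).
exists (size xs), (size ys), xi, eta, n_, m_, Phi_xi, Phi_eta, dimE'; split.
  by split=> // i j /eqP; rewrite (inj_eq xi_inj) => /eqP.
do 2!(split=> //); split=> [i j ij eta_ij|].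
  (* Distinct orbit representatives lie in distinct orbits. *)
  have [[t tE _] [t' tE' _]] := (etaP i, etaP j).
  have := orbit_repr_inj bar_period2 (xr t) (xr t'); rewrite tE tE' => eta_eq.
  by move/eqP: ij; apply; apply/eta_inj/eta_eq; right.
split=> [j|]; first by have [t tE _] := xiP j; apply: (fib_gt0 (inl j) t).
split=> [j|].
  have [t tE _] := etaP j; have fj := fib_gt0 (inr j) t tE.
  rewrite /m_ (bigD1 (Ordinal fj)) //= addn_gt0.
  by case: (c _).
split=> [//|]; split=> [j|].
  exists #|fib (inr j)|, (fun l => c (enum_val l)), erefl; split; last first.
    by move=> f; rewrite /castmap castmx_id.
  move=> l l' cl cl'; apply: contrapT => /eqP ll'.
  have := fam_block (enum_val l); have := fam_block (enum_val l').
  rewrite !fibE cl cl' => bl' bl.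
  apply: (block_rho_unique Psi_ext PsiE k0_skew k0E S_skew S_block S_contr
    (eta_bar j) bl bl').
  have := fam_orth (enum_val l) (enum_val l').
  by rewrite cl cl'; apply; rewrite (inj_eq enum_val_inj).
apply: unitarily_equivalent_trans PhiPsi _.
apply: (@frame_unitarily_equivalent R A _ _ dimE' W).
  have xi0 : (\mxcol_j W_xi j) *m (\mxcol_j W_eta j)^T = 0.
    apply: mxcol_mul_tr => i j; apply: castmx_mul0; apply: mxcol_mul_tr => l l'.
    by apply: v0; apply: fib_neq.
  rewrite /W tr_col_mx mul_col_row xi0 -[_ *m (\mxcol_j W_xi j)^T in X in block_mx _ _ X _]trmxK.
  rewrite [in X in block_mx _ _ X _]trmx_mul trmxK xi0 trmx0.
  rewrite !mxcol_orthonormal -?scalar_mx_block //.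
  - move=> j; apply: mxcol_orthonormal => [l|l l' ll']; first exact: F1.
    by apply: fam_orth; rewrite (inj_eq enum_val_inj).
  - move=> i j ij; apply: mxcol_mul_tr => l l'; apply: fam_orth.
    by apply: fib_neq; apply: contraNneq ij => -[->].
  - move=> j; apply: castmx_orthonormal; apply: mxcol_orthonormal => [l|l l' ll'].
      exact: v1.
    by apply: v00; rewrite (inj_eq enum_val_inj).
  - move=> i j ij; apply: castmx_mul0; rewrite -[LHS]trmxK trmx_mul trmxK.
    rewrite -[RHS]trmx0; congr trmx; apply: castmx_mul0.
    apply: mxcol_mul_tr => l l'; apply: v00.
    by apply: fib_neq; apply: contraNneq ij => -[->].
move=> f; rewrite /W mul_col_mx /dsum2 mul_block_col !mul0mx addr0 add0r.
congr col_mx.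
  apply: mxcol_intertwine => j; apply: castmx_intertwine.
  by apply: mxcol_intertwine => l; apply: vE.
apply: mxcol_intertwine => j; apply: mxcol_intertwine => l.
by rewrite /B_eta FE fibE.
Qed.

End NormalForm.

(** * Maps in normal form are C*-extreme *)

Section SplitForms.
Variables (R : realType) (Omega : topologicalType).
Hypothesis Omega_compact : compact [set: Omega].
Hypothesis Omega_hausdorff : hausdorff_space Omega.
Variable bar : Omega -> Omega.
Hypothesis bar_continuous : continuous bar.
Hypothesis bar_period2 : involutive bar.

Local Notation A := (COmega R bar).
Implicit Types f g h k : A.

Definition indicator n (z : pred 'I_n) : 'M[R]_n := dg (fun i => (z i)%:R).

(** [z] marks the coordinates of the summands rho_w with w nonreal. The last clause says that on the
    other coordinates odd functions have no Schwarz defect. *)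
Definition split_form n (M : A -> 'M[R]_n) (pt : 'I_n -> Omega) (z : pred 'I_n) :=
  [/\ forall g, selfadj g -> M g = dg (fun i => Ref g (pt i)),
      forall k, skewadj k -> M k *m indicator z = 0 &
      forall k, skewadj k -> (M k)^T *m M k *m indicator (predC z) =
        dg (fun i => Imf k (pt i) ^+ 2) *m indicator (predC z)].

Lemma indicator0 n : indicator (@pred0 'I_n) = 0.
Proof. by rewrite -(dg0 R n); apply: eq_dg. Qed.

Lemma indicatorT n : indicator (@predT 'I_n) = 1%:M.
Proof. by rewrite -(dg1 R n); apply: eq_dg. Qed.

Lemma indicatorC n (z : pred 'I_n) : indicator (predC z) = 1%:M - indicator z.
Proof.
rewrite -(dg1 R n) /indicator dgN dgD; apply: eq_dg => i /=.
by case: (z i); rewrite ?subrr ?subr0.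
Qed.

Lemma indicator_id n (z : pred 'I_n) : indicator z *m indicator z = indicator z.
Proof. by rewrite dgM; apply: eq_dg => i; case: (z i); rewrite ?mulr1 ?mulr0. Qed.

Theorem split_form_Cstar_ext n (Phi : A -> 'M[R]_n) pt (z : pred 'I_n) :
    UCP Phi -> split_form Phi pt z ->
    (forall i j, z i -> z j -> pt i = pt j \/ pt i = bar (pt j) -> i = j) ->
  UCP_Cstar_ext Phi.
Proof.
move=> PhiU [Phi_sa Phi_z Phi_zC] z_inj; split=> // m Psi T PsiU Tu TT PhiE j.
pose E := indicator z; pose E' := indicator (predC z).
have ET : E^T = E by apply: dgT.
have E'T : E'^T = E' by apply: dgT.
have EE : E *m E = E by apply: indicator_id.
have E'D : E' = 1%:M - E by apply: indicatorC.
have E'E : E' *m E = 0 by rewrite E'D mulmxBl mul1mx EE subrr.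
have EE' : E *m E' = 0 by rewrite E'D mulmxBr mulmx1 EE subrr.
have EE'1 : E' + E = 1%:M by rewrite E'D subrK.
have Phi_sa2 g : selfadj g -> Phi (smul (star g) g) = (Phi g)^T *m Phi g.
  move=> sg; rewrite (selfadj_star sg) !Phi_sa //; last exact: selfadjM.
  by rewrite dgT dgM; apply: eq_dg => i; rewrite RefM sg mulr0 subr0.
have Psi_sa g : selfadj g -> Psi j g *m T j = T j *m Phi g.
  move=> sg; have := UCP_sum_intertwine (X := 1%:M) (f := g) PsiU TT PhiE _ j.
  by rewrite Phi_sa2 // subrr mulmx0 mul0mx !mulmx1 => /(_ erefl).
have Psi_sk k : skewadj k -> Psi j k *m T j *m E' = T j *m Phi k *m E'.
  move=> sk; apply: (UCP_sum_intertwine PsiU TT PhiE).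
  rewrite -mulmxA mulmxBl Phi_zC // skewadj_star // Phi_sa.
    by rewrite (eq_dg (v := fun i => Imf k (pt i) ^+ 2)) ?subrr ?mulmx0 // => i;
       rewrite RefM RefN ImfN sk; ring.
  by move=> x; rewrite ImfM RefN ImfN sk; ring.
(* From here on only one piece is considered, through its two intertwining relations. *)
move: (T j) (Tu j) (Psi j) (PsiU j) Psi_sa Psi_sk => {Psi T PsiU Tu TT PhiE} T Tu Psi PsiU.
move=> Psi_sa Psi_sk.
have sym_sa (F : A -> 'M[R]_n) g : UCP F -> selfadj g -> (F g)^T = F g.
  by move=> FU sg; rewrite -(UCP_star FU) (selfadj_star sg).
have skew_sk (F : A -> 'M[R]_n) k : UCP F -> skewadj k -> (F k)^T = - F k.
  by move=> FU sk; rewrite -(UCP_star FU) (skewadj_star sk) (linear_fN (UCP_linear FU)).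
(* Psi inherits multiplicativity on self-adjoint functions from Phi, as T is invertible and
   intertwines the two there. *)
have Psi_sk2 k g : skewadj k -> selfadj g -> Psi k *m Psi g = Psi g *m Psi k.
  move=> sk sg.
  have gg : Psi (smul (star g) g) = (Psi g)^T *m Psi g.
    rewrite (sym_sa Psi) // selfadj_star //; apply: (can_inj (mulmxK Tu)).
    rewrite Psi_sa ?Phi_sa; try exact: selfadjM.
    rewrite -mulmxA Psi_sa // mulmxA Psi_sa // -mulmxA; congr (_ *m _).
    by rewrite Phi_sa // dgM; apply: eq_dg => i; rewrite RefM sg mulr0 subr0.
  have kg := UCP_multiplicative_domain PsiU gg k.
  have := congr1 trmx kg; rewrite trmx_mul (skew_sk _ _ PsiU sk) (sym_sa _ _ PsiU sg) mulmxN.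
  rewrite -(UCP_star PsiU) starM (skewadj_star sk) (selfadj_star sg).
  have -> : smul g (- k) = - smul k g.
    by apply: csym_ext => x; rewrite !(RefM, ImfM, RefN, ImfN, RefM, ImfM); ring.
  by rewrite (linear_fN (UCP_linear PsiU)) kg => /oppr_inj.
pose T' := (invmx T)^T.
have TT' : T^T *m T' = 1%:M by rewrite -trmx_mul mulVmx // trmx1.
have T'T : T'^T *m T = 1%:M by rewrite trmxK mulVmx.
have T'T2 : T' *m T^T = 1%:M by rewrite -trmx_mul mulmxV // trmx1.
have Psi_sa' g : selfadj g -> Psi g *m T' = T' *m Phi g.
  move=> sg; have := congr1 trmx (Psi_sa g sg).
  rewrite !trmx_mul (sym_sa _ _ PsiU sg) (sym_sa _ _ PhiU sg) => TPsi.
  by rewrite -[Psi g]mul1mx -T'T2 -(mulmxA T') TPsi -!mulmxA TT' mulmx1.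
have PsiE0 k : skewadj k -> Psi k *m T' *m E = 0.
  (* M is similar to Psi(k) and agrees with Phi(k) on the rows outside z, so its columns in z live
     on z. It commutes with every Phi(g), g self-adjoint, and the points of z lie in distinct
     orbits, so this corner is diagonal. *)
  move=> sk; pose M := T^T *m Psi k *m T'.
  have E'M : E' *m M = E' *m Phi k.
    have := congr1 trmx (Psi_sk k sk).
    rewrite !trmx_mul E'T (skew_sk _ _ PsiU sk) (skew_sk _ _ PhiU sk) !mulNmx !mulmxN.
    move=> /oppr_inj; rewrite /M !mulmxA => ->.
    by rewrite -(mulmxA _ T^T) TT' mulmx1.
  have MPhi g : selfadj g -> M *m Phi g = Phi g *m M.
    move=> sg; rewrite /M -mulmxA -Psi_sa' // !mulmxA -(mulmxA T^T) Psi_sk2 // !mulmxA.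
    have := congr1 trmx (Psi_sa g sg).
    by rewrite !trmx_mul (sym_sa _ _ PsiU sg) (sym_sa _ _ PhiU sg) => ->.
  have ME : M *m E = E *m M *m E.
    by rewrite -[M in LHS]mul1mx -EE'1 !mulmxDl E'M -mulmxA Phi_z // mulmx0 add0r.
  pose mu i := (E *m M *m E) i i.
  have MEd : M *m E = dg mu.
    rewrite ME; apply/matrixP => a b; rewrite dgE /mu; have [->|ab] := eqVneq a b.
      by rewrite mulr1n.
    rewrite mul_mx_dg mul_dg mulr0n.
    have [za|] := boolP (z a); last by rewrite !mul0r.
    have [zb|] := boolP (z b); last by rewrite mulr0.
    have [|g [sg ga gb]] := @selfadj_separate R Omega Omega_compact Omega_hausdorff bar
        bar_continuous bar_period2 [:: pt a] [:: pt b].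
      move=> x y /[!inE]/eqP -> /eqP ->.
      by split=> pab; move/eqP: ab; apply; apply: z_inj; rewrite // pab; auto.
    have /matrixP/(_ a b) := MPhi g sg.
    rewrite Phi_sa // mul_mx_dg mul_dg /= (ga (pt a)) ?(gb (pt b)) ?mem_head //.
    by rewrite mulr0 mul1r => <-; rewrite mul0r.
  have T'M : Psi k *m T' *m E = T' *m dg mu.
    by rewrite -MEd /M !mulmxA T'T2 mul1mx.
  have mu0 i : mu i = 0.
    have [zi|zi] := boolP (z i); last first.
      by rewrite /mu mul_mx_dg (negbTE zi) mulr0.
    (* G is skew, and its i-th diagonal entry is mu_i times the squared norm of the i-th column of
       the invertible matrix T'. *)
    pose G := E *m T'^T *m (Psi k *m T' *m E).
    have GT : G^T = - G.
      by rewrite /G; mx_expand; rewrite ET (skew_sk _ _ PsiU sk); mx_expand.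
    have : G i i = 0.
      have /matrixP/(_ i i) := GT; rewrite mxE mxNE => /eqP.
      by rewrite -addr_eq0 -mulr2n mulrn_eq0 /= => /eqP.
    rewrite /G T'M mulmxA mul_mx_dg -mulmxA mul_dg zi mul1r => /eqP.
    rewrite mulf_eq0 => /orP[|/eqP //].
    rewrite mxE => /eqP T'i; have : (T^T *m T') i i = 1 by rewrite TT' mxE eqxx.
    rewrite mxE big1 ?(eqP _) => [/esym/eqP|l _]; first by rewrite oner_eq0.
    move/eqP: T'i; rewrite psumr_eq0 => [/allP/(_ l (mem_index_enum _))|q _].
      by rewrite /= mxE mulf_eq0 orbb => /eqP ->; rewrite mulr0.
    by rewrite mxE -expr2 sqr_ge0.
  by rewrite T'M (eq_dg (v := fun=> 0)) // dg0 mulmx0.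
pose C := T *m E' + T' *m E.
have Cu : C \in unitmx.
  rewrite -unitmx_tr -row_free_unit -kermx_eq0; apply: contraT.
  move=> /rowV0Pn[u /sub_kermxP uC un0].
  (* The columns of T E' and T' E are mutually orthogonal, because T'^T T = 1 and E E' = 0; so a
     kernel vector can be tested on each part separately. *)
  have CTE' : C^T *m (T *m E') = E' *m T^T *m T *m E'.
    rewrite /C trmxD !trmx_mul E'T ET mulmxDl !mulmxA -(mulmxA E) T'T mulmx1 EE'.
    by rewrite addr0.
  have uE'0 : u *m E' = 0.
    have : (u *m E' *m T^T) *m (u *m E' *m T^T)^T = 0.
      rewrite !trmx_mul trmxK E'T !mulmxA.
      have -> : u *m E' *m T^T *m T *m E' = u *m (C^T *m (T *m E')).
        by rewrite CTE' !mulmxA.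
      by rewrite (mulmxA u) uC !mul0mx.
    move=> /(congr1 (fun X : 'M[R]_1 => X 0 0)); rewrite [RHS]mxE => /row_norm_eq0 uE'T0.
    by rewrite -[u *m E']mulmx1 -TT' mulmxA uE'T0 mul0mx.
  have uE0 : u *m E = 0.
    move: uC; rewrite /C trmxD !trmx_mul E'T ET mulmxDr !mulmxA uE'0 mul0mx add0r.
    by move=> uET'; rewrite -[u *m E]mulmx1 -T'T mulmxA uET' mul0mx.
  by rewrite -[u]mulmx1 -EE'1 mulmxDr uE'0 uE0 addr0 eqxx in un0.
apply: (similar_unitarily_equivalent (UCP_star PhiU) (UCP_star PsiU) Cu) => a.
have [g [k [sg sk ->]]] := csym_decomp a.
rewrite (linear_fD (UCP_linear PsiU)) (linear_fD (UCP_linear PhiU)) (mulmxDl (Psi g)) (mulmxDr C).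
congr (_ + _).
  have comE (y : pred 'I_n) : Phi g *m indicator y = indicator y *m Phi g.
    by rewrite Phi_sa // !dgM; apply: eq_dg => i; rewrite mulrC.
  by rewrite /C mulmxDr mulmxDl !mulmxA Psi_sa // Psi_sa' // -!mulmxA /E /E' !comE.
have PhikE' : Phi k *m E' = Phi k by rewrite E'D mulmxBr mulmx1 Phi_z // subr0.
have EPhik : E *m Phi k = 0.
  have := congr1 trmx (Phi_z k sk); rewrite trmx_mul ET (skew_sk _ _ PhiU sk) mulmxN trmx0.
  by move=> /eqP; rewrite oppr_eq0 => /eqP.
rewrite /C mulmxDr mulmxDl !mulmxA PsiE0 // addr0 Psi_sk // -mulmxA PhikE'.
by rewrite -[T' *m E *m _]mulmxA EPhik mulmx0 addr0 E'D mulmxBr mulmx1 mulmxBl -mulmxA EPhik mulmx0 subr0.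
Qed.

End SplitForms.

(** * Direct sums of the elementary maps as split forms *)

Section BlockDiagonal.
Variable R : realType.

Lemma mxdiagM k (d : 'I_k -> nat) (M N : forall i, 'M[R]_(d i)) :
  (\mxdiag_i M i) *m (\mxdiag_i N i) = \mxdiag_i (M i *m N i).
Proof.
rewrite {2}/mxdiag mul_mxdiag_mxblock; apply/eq_mxblock => i j.
by case: eqVneq => [<-|]; rewrite ?conform_mx_id ?mulmx0.
Qed.

Lemma mxdiag_dg k (d : 'I_k -> nat) (u : forall i, 'I_(d i) -> R) :
  \mxdiag_i dg (u i) = dg (fun s => u (tagnat.sig1 s) (tagnat.sig2 s)).
Proof.
rewrite /dg -diag_mxrow; congr diag_mx; apply/rowP => s.
by rewrite !mxE.
Qed.

Lemma block_dg d1 d2 (u : 'I_d1 -> R) (v : 'I_d2 -> R) :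
  block_mx (dg u) 0 0 (dg v) =
  dg (fun i => match fintype.split i with inl a => u a | inr b => v b end).
Proof.
apply/matrixP => i j; rewrite -(splitK i) -(splitK j) dgE unsplitK (can_eq unsplitK).
case: (fintype.split i) => a; case: (fintype.split j) => b /=;
  by rewrite ?block_mxEul ?block_mxEur ?block_mxEdl ?block_mxEdr ?dgE ?mxE.
Qed.

End BlockDiagonal.

Section Splits.
Variables (R : realType) (Omega : topologicalType) (bar : Omega -> Omega).
Hypothesis bar_period2 : involutive bar.

Local Notation A := (COmega R bar).
Implicit Types f g h : A.

Definition same_orbit x y := x = y \/ x = bar y.

(* [Z] bounds the points at which a summand [rho_w] with [w <> bar w] sits. *)
Definition splits d (M : A -> 'M[R]_d) (Z : Omega -> Prop) :=
  exists pt z, [/\ split_form M pt z, forall i, z i -> Z (pt i) &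
    forall i j, z i -> z j -> same_orbit (pt i) (pt j) -> i = j].

Lemma splits_cast d d' (e : d = d') (M : A -> 'M[R]_d) Z :
  splits M Z -> splits (castmap e M) Z.
Proof.
by case: d' / e => -[pt [z [[Mg Mk Mk2] zZ z_inj]]]; exists pt, z.
Qed.

Lemma splits_dsum k (d : 'I_k -> nat) (M : forall i, A -> 'M[R]_(d i))
    (Z : 'I_k -> Omega -> Prop) :
    (forall i, splits (M i) (Z i)) ->
    (forall i j x y, Z i x -> Z j y -> same_orbit x y -> i = j) ->
  splits (dsum M) (fun x => exists i, Z i x).
Proof.
move=> MZ Z_inj; pose pt_ i := sval (cid (MZ i)).
pose z_ i := sval (cid (svalP (cid (MZ i)))).
have spec i : [/\ split_form (M i) (pt_ i) (z_ i), forall a, z_ i a -> Z i (pt_ i a) &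
    forall a b, z_ i a -> z_ i b -> same_orbit (pt_ i a) (pt_ i b) -> a = b].
  exact: svalP (cid (svalP (cid (MZ i)))).
pose pt s := pt_ (tagnat.sig1 s) (tagnat.sig2 s).
pose z s := z_ (tagnat.sig1 s) (tagnat.sig2 s).
have indE : indicator R z = \mxdiag_i indicator R (z_ i).
  by rewrite /indicator mxdiag_dg.
have indCE : indicator R (predC z) = \mxdiag_i indicator R (predC (z_ i)).
  by rewrite /indicator mxdiag_dg.
exists pt, z; split.
- split=> [g sg|h sh|h sh].
  + rewrite /dsum -(mxdiag_dg (fun i a => Ref g (pt_ i a))); apply/eq_mxdiag => i.
    by have [[Mg _ _] _ _] := spec i; apply: Mg.
  + rewrite /dsum indE mxdiagM -[RHS]mxdiag0; apply/eq_mxdiag => i.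
    by have [[_ Mk _] _ _] := spec i; apply: Mk.
  + rewrite /dsum indCE -(mxdiag_dg (fun i a => Imf h (pt_ i a) ^+ 2)) tr_mxdiag !mxdiagM.
    apply/eq_mxdiag => i.
    by have [[_ _ Mk2] _ _] := spec i; apply: Mk2.
- move=> s zs; exists (tagnat.sig1 s).
  by have [_ zZ _] := spec (tagnat.sig1 s); apply: zZ.
- move=> s t zs zt st; apply: (can_inj tagnat.sigK); move: zs zt st.
  rewrite /z /pt /tagnat.sig1 /tagnat.sig2.
  case: (tagnat.sig s) (tagnat.sig t) => i a [j b] /= za zb st.
  have [_ zZi z_inj] := spec i; have [_ zZj _] := spec j.
  have ij := Z_inj _ _ _ _ (zZi _ za) (zZj _ zb) st.
  by case: j / ij b zb zZj st => b zb _ st; rewrite (z_inj _ _ za zb st).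
Qed.

Lemma splits_dsum2 d1 d2 (M1 : A -> 'M[R]_d1) (M2 : A -> 'M[R]_d2) (Z1 Z2 : Omega -> Prop) :
    splits M1 Z1 -> splits M2 Z2 ->
    (forall x y, Z1 x -> Z2 y -> same_orbit x y \/ same_orbit y x -> False) ->
  splits (dsum2 M1 M2) (fun x => Z1 x \/ Z2 x).
Proof.
move=> [pt1 [z1 [[Mg1 Mk1 Mk21] zZ1 z_inj1]]] [pt2 [z2 [[Mg2 Mk2 Mk22] zZ2 z_inj2]]] Z12.
pose pt i := match fintype.split i with inl a => pt1 a | inr b => pt2 b end.
pose z i := match fintype.split i with inl a => z1 a | inr b => z2 b end.
have indE (y1 : pred 'I_d1) (y2 : pred 'I_d2) (y : pred 'I_(d1 + d2)) :
    (forall i, y i = match fintype.split i with inl a => y1 a | inr b => y2 b end) ->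
    indicator R y = block_mx (indicator R y1) 0 0 (indicator R y2).
  move=> yE; rewrite /indicator block_dg; apply: eq_dg => i; rewrite yE.
  by case: (fintype.split i).
have dgE2 (u : Omega -> R) : dg (fun i => u (pt i)) =
    block_mx (dg (fun a => u (pt1 a))) 0 0 (dg (fun b => u (pt2 b))).
  by rewrite block_dg; apply: eq_dg => i; rewrite /pt; case: (fintype.split i).
exists pt, z; split.
- split=> [g sg|h sh|h sh].
  + by rewrite (dgE2 (Ref g)) /dsum2 Mg1 // Mg2.
  + rewrite (indE z1 z2) // /dsum2 mulmx_block !mul0mx !mulmx0 Mk1 // Mk2 //.
    by rewrite !addr0 block_mx0.
  + rewrite (indE (predC z1) (predC z2)); last first.
      by move=> i; rewrite /z /=; case: (fintype.split i).
    rewrite (dgE2 (fun x => Imf h x ^+ 2)) /dsum2 tr_block_mx !mulmx_block !trmx0.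
    by rewrite !(mul0mx, mulmx0, addr0, add0r) Mk21 // Mk22.
- move=> i; rewrite /z /pt; case: (fintype.split i) => a za; [left|right].
    exact: zZ1.
  exact: zZ2.
- move=> i j; rewrite /z /pt => zi zj ij; apply: (can_inj splitK); move: zi zj ij.
  case: (fintype.split i) (fintype.split j) => a [b|b] za zb ab.
  + by rewrite (z_inj1 _ _ za zb ab).
  + by case: (Z12 _ _ (zZ1 _ za) (zZ2 _ zb)); left.
  + by case: (Z12 _ _ (zZ1 _ zb) (zZ2 _ za)); right.
  + by rewrite (z_inj2 _ _ za zb ab).
Qed.

Lemma rho_selfadj g (w : Omega) : rho w g = dg (fun=> Ref g w).
Proof. by apply/matrixP => i j; rewrite !mxE. Qed.

Lemma rho_skewadj h (w : Omega) : skewadj h -> rho w h = 0.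
Proof.
by move=> sh; rewrite rho_selfadj -(dg0 R 1); apply: eq_dg => i; apply: sh.
Qed.

(** No coordinate is marked: odd functions vanish at a real point, so both sides of the last clause
    are 0. *)
Lemma splits_rho_real w : w = bar w -> splits (@rho R Omega bar w) (fun=> False).
Proof.
move=> ww; exists (fun=> w), pred0; split=> //; split=> [g sg|h sh|h sh].
- exact: rho_selfadj.
- by rewrite rho_skewadj // mul0mx.
- have h0 : Imf h w = 0.
    have : Imf h w = - Imf h w by rewrite {1}ww Imf_bar.
    by move=> /eqP; rewrite -addr_eq0 -mulr2n mulrn_eq0 /= => /eqP.
  rewrite rho_skewadj // mulmx0; congr (_ *m _).
  by rewrite -(dg0 R 1); apply: eq_dg => i; rewrite h0 expr0n.
Qed.

Lemma splits_rho w : splits (@rho R Omega bar w) (eq w).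
Proof.
exists (fun=> w), predT; split=> [||i j _ _ _]; last by rewrite !ord1.
- split=> [g sg|h sh|h sh].
  + exact: rho_selfadj.
  + by rewrite rho_skewadj // mul0mx.
  + have -> : indicator R (predC predT) = 0 :> 'M_1.
      by rewrite -(dg0 R 1); apply: eq_dg.
    by rewrite !mulmx0.
- by [].
Qed.

(** No coordinate is marked: for odd h the matrix Pi_w(h) is a quarter turn scaled by Im h(w), so
    its Gram matrix is the scalar (Im h(w))^2. *)
Lemma splits_Pi w : splits (@Pi R Omega bar w) (fun=> False).
Proof.
exists (fun=> w), pred0; split=> //.
have ind1 : indicator R (predC pred0) = 1%:M :> 'M_2.
  by rewrite -(dg1 R 2); apply: eq_dg.
have scE (a : R) : dg (fun _ : 'I_2 => a) = a%:M by apply/matrixP => i j; rewrite !mxE.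
have sc0 : (0 : R)%:M = 0 :> 'M_1 by apply/matrixP => i j; rewrite !mxE mul0rn.
split=> [g sg|h sh|h sh].
- rewrite scE -[LHS]/(block_mx (Ref g w)%:M (Imf g w)%:M (- Imf g w)%:M (Ref g w)%:M).
  by rewrite sg oppr0 sc0 -scalar_mx_block.
- by rewrite indicator0 mulmx0.
- rewrite ind1 !mulmx1 scE.
  pose P : 'M[R]_(1 + 1) :=
    block_mx (Ref h w)%:M (Imf h w)%:M (- Imf h w)%:M (Ref h w)%:M.
  rewrite -[LHS]/(P^T *m P) /P.
  rewrite tr_block_mx !tr_scalar_mx sh mulmx_block -!scalar_mxM -!raddfD /=.
  by rewrite !(mulr0, mul0r, mulrNN, addr0, add0r) -!expr2 sc0 -scalar_mx_block.
Qed.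

Lemma splits_in_E w m (M : A -> 'M[R]_m) : in_E w M -> splits M (eq w).
Proof.
move=> [k [c [e [c_inj ME]]]].
have -> : M = castmap e (dsum (fun i => summand_map w (c i))) by apply: funext.
apply: splits_cast.
(* Only a summand rho_w can hold a marked coordinate, and there is at most one, so no two indices
   compete for the orbit of w. *)
pose Z i := if c i is Srho then eq w else fun=> False.
have [||pt [z [Msplit zZ z_inj]]] := @splits_dsum k _ (fun i => summand_map w (c i)) Z.
- move=> i; rewrite /Z; case: (c i); [exact: splits_rho|exact: splits_Pi|exact: splits_Pi].
- move=> i j x y Zi Zj _; apply: c_inj; first by move: Zi; rewrite /Z; case: (c i).
  by move: Zj; rewrite /Z; case: (c j).
exists pt, z; split=> // i /zZ[j]; rewrite /Z; case: (c j) => //.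
Qed.

End Splits.

(** The marked coordinates of the direct sum sit at the eta_j, one at most for each j, and the
    separation of the eta_j puts them in distinct orbits. Extremality of the direct sum is then
    carried to Phi by the orthogonal equivalence. *)
Lemma normal_form_Cstar_ext (R : realType) (Omega : topologicalType)
    (bar : Omega -> Omega) n (Phi : COmega R bar -> 'M[R]_n) :
    compact [set: Omega] -> hausdorff_space Omega -> continuous bar ->
    involutive bar -> UCP Phi -> normal_form Phi ->
  UCP_Cstar_ext Phi.
Proof.
move=> Omega_compact Omega_hausdorff bar_continuous bar_period2 PhiU.
move=> [p [q [xi [eta [n_ [m_ [Phi_xi [Phi_eta [dimE]]]]]]]]].
move=> [[xi_inj eta_inj xi_eta] [xi_bar [eta_bar [eta_sep [_ [_ [Phi_xiE [Phi_etaE]]]]]]]].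
set Phi0 := castmap _ _ => PhiPhi0.
have [U [UU UU'] Phi0E] := PhiPhi0.
have Phi0U : UCP Phi0.
  by have -> : Phi0 = (fun a => Ad U (Phi a)); [exact: funext | apply: UCP_Ad].
have Phi0_ext : UCP_Cstar_ext Phi0.
  have xiS i : splits (Phi_xi i) (fun=> False).
    have rhoS (l : 'I_(n_ i)) := @splits_rho_real R Omega bar _ (xi_bar i).
    rewrite Phi_xiE; have [|pt [z [sf zZ z_inj]]] :=
      splits_cast (sum1_ord (n_ i)) (splits_dsum rhoS _); first by [].
    by exists pt, z; split=> // a /zZ[].
  have etaS i : splits (Phi_eta i) (eq (eta i)) by apply: splits_in_E.
  have eta_orb i j x y : eta i = x -> eta j = y -> same_orbit bar x y -> i = j.
    move=> <- <- []; first exact: eta_inj.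
    by move=> etaE; apply: contrapT => /eqP/eta_sep.
  have [||pt [z [sf _ z_inj]]] :=
      splits_cast dimE (splits_dsum2 (splits_dsum xiS _) (splits_dsum etaS eta_orb) _).
  - by [].
  - by move=> x y [].
  exact: (split_form_Cstar_ext Omega_compact Omega_hausdorff bar_continuous
    bar_period2 Phi0U sf).
have [V [VV VV'] PhiE] := unitarily_equivalent_sym PhiPhi0.
have -> : Phi = (fun a => Ad V (Phi0 a)) by apply: funext.
exact: UCP_Cstar_ext_Ad.
Qed.

Theorem theorem4p10 (R : realType) (Omega : topologicalType)
    (Omega_compact : compact [set: Omega])
    (Omega_hausdorff : hausdorff_space Omega)
    (bar : Omega -> Omega)
    (bar_continuous : continuous bar) (bar_period2 : involutive bar)
    (n : nat) (n_gt0 : (0 < n)%N)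
    (Phi : COmega R bar -> 'M[R]_n) (Phi_UCP : UCP Phi) :
  UCP_Cstar_ext Phi <->
  exists (p q : nat) (xi : 'I_p -> Omega) (eta : 'I_q -> Omega)
         (n_ : 'I_p -> nat) (m_ : 'I_q -> nat)
         (Phi_xi : forall j, COmega R bar -> 'M[R]_(n_ j))
         (Phi_eta : forall j, COmega R bar -> 'M[R]_(m_ j))
         (dimE : (\sum_(j < p) n_ j + \sum_(j < q) m_ j)%N = n),
    [/\ injective xi, injective eta & forall i j, xi i <> eta j] /\
    (forall j, xi j = bar (xi j)) /\
    (forall i, eta i <> bar (eta i)) /\
    (forall i j, i != j -> eta i <> bar (eta j)) /\
    (forall j, (0 < n_ j)%N) /\ (forall j, (0 < m_ j)%N) /\
    (forall j, Phi_xi j = rho_copies (xi j) (n_ j)) /\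
    (forall j, in_E (eta j) (Phi_eta j)) /\
    unitarily_equivalent Phi
      (castmap dimE (dsum2 (dsum Phi_xi) (dsum Phi_eta))).
Proof.
split=> [|Phi_nf].
  exact: (Cstar_ext_normal_form Omega_compact Omega_hausdorff bar_continuous bar_period2 n_gt0).
exact: (normal_form_Cstar_ext Omega_compact Omega_hausdorff bar_continuous bar_period2 Phi_UCP Phi_nf).
Qed.
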